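(* There exist $\delta>0$ and $c>0$ such that for every even function $\epsilon\in H^1(\mathbb{R})$ with $(\epsilon,Q^3)_{L^2}=(\epsilon,iQ^3)_{L^2}=0$, $\|\epsilon\|_{L^2}\le\delta$ and $\|Q+\epsilon\|_{L^2}=\|Q\|_{L^2}$, one has $$E(Q+\epsilon)\ge c\,\|\epsilon\|_{H^1}^2 = c\Big(\int|\epsilon_x|^2\,dx + \int|\epsilon|^2\,dx\Big).$$
   Context: $Q(x)=(3/\cosh^2(2x))^{1/4}$; $(f,g)_{L^2}=\mathrm{Re}\int f\bar g$; $E(v)=\frac12\int|v_x|^2\,dx-\frac16\int|v|^6\,dx$. *)

(* Defs.v *)
From HB Require Import structures.
From mathcomp Require Import all_boot all_order all_algebra.
From mathcomp Require Import all_classical all_reals all_analysis.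
Set Implicit Arguments. Unset Strict Implicit. Unset Printing Implicit Defensive.
Import Order.TTheory GRing.Theory Num.Theory.
Import numFieldNormedType.Exports.
Local Open Scope classical_set_scope.
Local Open Scope ring_scope.

Section Defs.
Variable R : realType.

Definition leb := (@lebesgue_measure R).

Definition cosh (x : R) : R := (expR x + expR (- x)) / 2.

Definition Q (x : R) : R := powR (3 / (cosh (2 * x)) ^+ 2) (1 / 4).

(* classical derivative of Q (Q is smooth) *)
Definition dQ : R -> R := derive1 Q.

Definition test_fun (phi : R -> R) : Prop :=
  (forall (n : nat) (x : R), derivable (derive1n n phi) x 1) /\
  exists M : R, forall x : R, M < `|x| -> phi x = 0.

Definition L2 (u : R -> R) : Prop :=
  measurable_fun setT u /\
  (\int[leb]_x ((u x) ^+ 2)%:E < +oo)%E.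

Definition weak_deriv (u g : R -> R) : Prop :=
  forall phi, test_fun phi ->
    (\int[leb]_x (u x * derive1 phi x)%:E =
     - \int[leb]_x (g x * phi x)%:E)%E.

Definition H1 (u du : R -> R) : Prop := L2 u /\ L2 du /\ weak_deriv u du.

(* A complex-valued function is represented by its real and imaginary
   parts (u, v), with weak derivatives (du, dv).  *)

Definition L2norm2 (u v : R -> R) : \bar R :=
  (\int[leb]_x ((u x) ^+ 2 + (v x) ^+ 2)%:E)%E.

Definition energy (u v du dv : R -> R) : \bar R :=
  ((2^-1)%:E * \int[leb]_x ((du x) ^+ 2 + (dv x) ^+ 2)%:E
   - (6^-1)%:E * \int[leb]_x (((u x) ^+ 2 + (v x) ^+ 2) ^+ 3)%:E)%E.

End Defs.

(* Main.v *)
(* With L_+ = -d^2 + 1 - 5 Q^4 and L_- = -d^2 + 1 - Q^4, the equation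
   Q'' - Q + Q^5 = 0, the Pohozaev identity E(Q) = 0 and the mass constraint
   reduce E(Q + eps) to (<L_+ u, u> + <L_- v, v>) / 2 plus terms that are at
   least cubic in eps; by Gagliardo-Nirenberg these are absorbed when the L^2
   norm of eps is small, whatever its H^1 norm.
   Coercivity rests on supersymmetric factorizations.  Write th = tanh (2x) and
   A_n = d/dx + n th, which annihilates Q^n.  Then L_- = A_1^* A_1 and
   L_+ + 8 = A_3^* A_3, whereas A_1 A_1^* >= 1 and A_3 A_3^* = L_- + 8.  If g is
   orthogonal to Q^n, then g = A_n^* f with f = - Q^-n int_(-oo)^x Q^n g in L^2,
   so that |g|^2 = <f, A_n g>.  For n = 1 this gives L_- >= 1 on Q^perp.  For
   n = 3 and g even, f is odd, hence orthogonal to Q, hence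
   |g|^2 = <A_3 A_3^* f, f> >= 9 |f|^2, which gives L_+ >= 1.
   An H^1 function is only given through its weak derivative: testing against
   differences of mollifiers and passing to Lebesgue points yields an absolutely
   continuous representative, for which the product rule and the vanishing of
   the boundary terms at infinity justify all integrations by parts. *)
Require Import Defs.
From HB Require Import structures.
From mathcomp Require Import all_boot all_order all_algebra.
From mathcomp Require Import all_classical all_reals all_analysis.
From mathcomp Require Import measurable_realfun ring lra.
Import Order.TTheory GRing.Theory Num.Theory.
Import numFieldNormedType.Exports.
Local Open Scope classical_set_scope.
Local Open Scope ring_scope.
Set Implicit Arguments.
Unset Strict Implicit.
Unset Printing Implicit Defensive.

(** * Absolutely continuous functions *)

Section AbsolutelyContinuous.
Variable R : realType.
Local Notation mu := (@lebesgue_measure R).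
Implicit Types (f g h F G : R -> R) (a b c d e x y z t : R).

(** The shift 8 appears because A_3 annihilates Q^3: this is the eigenfunction of [L_+] with
    eigenvalue -8, and orthogonality to it removes the negative direction. The odd function Q' = -
    A_3^* Q / 4 lies in the kernel of [L_+]; evenness excludes it by making f odd, hence orthogonal
    to Q. For [L_-] the ground state is Q, not Q^3; since (Q, Q^3) > 0, subtracting a multiple of
    Q^3 restores orthogonality to Q at the price of a smaller constant. The delicate point is that f
    is square integrable, because its formula multiplies a tail integral by the exploding weight
    Q^-n. This takes two rounds: a weighted tail estimate makes f bounded, then an energy identity
    on [-N, N], whose boundary terms that bound controls, gives f and f' in L^2. Smallness is
    assumed in L^2 only, so r = |eps| need not be pointwise small. The cubic terms are split as r^3
    <= eta r^2 + r^6 / eta^3, and the integral of r^6 is at most 8 |eps|^4 |eps_x|^2 in L^2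
    norms. *)

Definition locint f := forall a b, mu.-integrable `[a, b] (EFin \o f).

(** Encoded by the fundamental theorem of calculus, so that [f] matters only almost everywhere and
    can be the given weak derivative itself. *)
Definition AC F f := locint f /\
  forall a b, a <= b -> F b - F a = \int[mu]_(x in `[a, b]) f x.

(** Supremum argument: the points reachable from [a] have a supremum [s], and the local hypothesis
    at [s] leads beyond [s] unless [b] has been reached. *)
Lemma segment_induction (P : R -> R -> Prop) a b : a <= b ->
  (forall x, a <= x <= b -> exists2 d, 0 < d &
     forall y z, x - d < y -> y <= x -> x <= z -> z < x + d -> P y z) ->
  (forall x y z, x <= y -> y <= z -> P x y -> P y z -> P x z) -> P a b.
Proof.
move=> ab loc trans.
pose S := [set x | a <= x <= b /\ P a x].
have Sa : S a.
  split; first by rewrite lexx.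
  have [|d d0 H] := loc a; first by rewrite lexx.
  by apply: H => //; lra.
have supS : has_sup S by split; [exists a | exists b => x [/andP[]]].
set s := sup S.
have as_ : a <= s by apply: ub_le_sup => //; case: supS.
have sb : s <= b by apply: ge_sup; [exists a | move=> x [/andP[]]].
have [|d d0 H] := loc s; first by rewrite as_.
have [x Sx sx] := sup_adherent d0 supS.
have xs : x <= s by apply: ub_le_sup => //; case: supS.
have [[/andP[ax _] Pax] {}sx] := (Sx, sx).
have [bs|bs] := ltP b (s + d / 2).
  apply: (trans a x b) => //; first lra.
  by apply: H; rewrite -/s in sx *; lra.
have S' : S (s + d / 2).
  split; first by apply/andP; split; lra.
  by apply: (trans a x) => //; [lra | apply: H; rewrite -/s in sx *; lra].
have : s + d / 2 <= s by apply: ub_le_sup => //; case: supS.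
by rewrite -subr_ge0; lra.
Qed.

Lemma Rintegral_itv_cat f a b c : locint f -> a <= b -> b <= c ->
  \int[mu]_(x in `[a, c]) f x =
  \int[mu]_(x in `[a, b]) f x + \int[mu]_(x in `[b, c]) f x.
Proof.
move=> lf ab bc.
have := @Rintegral_itvB R f (BLeft a) (BRight c) b (lf a c).
rewrite !bnd_simp => /(_ ab bc) /eqP; rewrite subr_eq => /eqP ->.
rewrite addrC; congr (_ + _); apply: Rintegral_itv_obnd_cbnd.
apply: integrableS (lf a c) => //; apply: subset_itvr.
by rewrite bnd_simp.
Qed.

Lemma continuous_locint f : continuous f -> locint f.
Proof.
move=> cf a b; apply: continuous_compact_integrable.
  exact: segment_compact.
exact: continuous_subspaceT.
Qed.

Lemma locintD f g : locint f -> locint g -> locint (fun x => f x + g x).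
Proof. by move=> lf lg a b; apply: (integrableD _ (lf a b) (lg a b)). Qed.

Lemma locintZ f c : locint f -> locint (fun x => c * f x).
Proof. by move=> lf a b; apply: (integrableZl _ c (lf a b)). Qed.

Lemma locint_norm f : locint f -> locint (fun x => `|f x|).
Proof. by move=> lf a b; exact: (integrable_norm (lf a b)). Qed.

Lemma locintM f g : continuous f -> locint g -> locint (fun x => f x * g x).
Proof.
move=> cf lg a b.
apply: (@integrableMr _ _ _ mu _ _ f (EFin \o g) _ _ (lg a b)) => //.
  by apply/measurable_funTS; exact: continuous_measurable_fun.
have : {within `[a, b], continuous f} by exact: continuous_subspaceT.
move=> /continuous_compact/(_ (@segment_compact R a b))/compact_bounded[M [_ mrt]].
by exists M; split; rewrite ?num_real // => ? ? ? ?; exact: mrt.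
Qed.

Lemma eq_locint f g : f =1 g -> locint f -> locint g.
Proof. by move=> /funext ->. Qed.

Lemma AC_continuous F f : AC F f -> continuous F.
Proof.
move=> [lf Ff] x.
have x12 : x - 1 <= x + 1 by lra.
have := @parameterized_integral_continuous R (x - 1) (x + 1) f x12 (lf _ _).
move=> /(continuous_within_itvP _ _) => H.
have [|] := H; first lra.
move=> + _ _ => /(_ x); rewrite in_itv/= => cx.
have : {for x, continuous (fun y => F (x - 1) + \int[mu]_(t in `[x - 1, y]) f t)}.
  apply: cvgD; first exact: cvg_cst.
  by apply: cx; apply/andP; split; lra.
rewrite /prop_for /continuous_at -(Ff (x - 1) x); last lra.
rewrite [X in _ --> X -> _]addrC subrK; apply: cvg_trans.
apply: near_eq_cvg; near=> y; rewrite -Ff; first by rewrite addrC subrK.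
near: y; exists 1 => //= y; rewrite /= ltr_norml => /andP[? ?]; lra.
Unshelve. all: by end_near. Qed.

Lemma AC_cst c : AC (fun=> c) (fun=> 0).
Proof.
split; first by apply: continuous_locint; exact: cst_continuous.
by move=> a b ab; rewrite subrr Rintegral_cst//= mul0r.
Qed.

Lemma AC_derive F f : (forall x : R, is_derive x 1 F (f x)) -> continuous f ->
  AC F f.
Proof.
move=> dF cf; split; first exact: continuous_locint.
move=> a b; rewrite le_eqVlt => /predU1P[<-|ab].
  by rewrite subrr set_itv1 Rintegral_set1.
have dF1 x : derivable F x 1 by have := dF x; case.
have cF : continuous F.
  by move=> x; apply/differentiable_continuous/derivable1_diffP/dF1.
rewrite /Rintegral (@continuous_FTC2 R f F a b ab) //.
- exact: continuous_subspaceT.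
- split; first by move=> x _; exact: dF1.
  + exact/cvg_at_right_filter/cF.
  + exact/cvg_at_left_filter/cF.
- by move=> x _; rewrite derive1E; have := dF x; case.
Qed.

Lemma AC_eq F f G g : F =1 G -> f =1 g -> AC F f -> AC G g.
Proof. by move=> /funext -> /funext ->. Qed.

Lemma ACD F f G g : AC F f -> AC G g -> AC (fun x => F x + G x) (fun x => f x + g x).
Proof.
move=> [lf Ff] [lg Gg]; split; first exact: locintD.
by move=> a b ab; rewrite RintegralD// -Ff// -Gg//; ring.
Qed.

(* The product rule need only hold up to [e * int (|f| + |g|)] on short intervals:
   such bounds add up, which replaces differentiation almost everywhere. *)
Lemma AC_local F f G g x e : 0 < e -> AC F f -> AC G g ->
  exists2 d, 0 < d & forall y z, x - d < y -> y <= x -> x <= z -> z < x + d ->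
  `|F z * G z - F y * G y - \int[mu]_(t in `[y, z]) (F t * g t + G t * f t)| <=
  e * \int[mu]_(t in `[y, z]) (`|f t| + `|g t|).
Proof.
move=> e0 ACF ACG.
have [cF cG] := (AC_continuous ACF, AC_continuous ACG).
have [[lf Ff] [lg Gg]] := (ACF, ACG).
have e20 : 0 < e / 2 by lra.
have /cvgrPdist_lt /(_ _ e20) /= [d1 d10 H1] := cF x.
have /cvgrPdist_lt /(_ _ e20) /= [d2 d20 H2] := cG x.
exists (Num.min d1 d2); first by rewrite lt_min d10.
set d := Num.min d1 d2.
have [dd1 dd2] : d <= d1 /\ d <= d2 by rewrite !ge_min !lexx orbT.
move=> y z xy yx xz zx; have yz := le_trans yx xz.
have nF t : y <= t <= z -> `|F x - F t| < e / 2.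
  move=> /andP[yt tz]; apply: H1; rewrite /= ltr_norml; lra.
have nG t : y <= t <= z -> `|G x - G t| < e / 2.
  move=> /andP[yt tz]; apply: H2; rewrite /= ltr_norml; lra.
(* The splitting F z G z - F y G y = F z (G z - G y) + G y (F z - F y) leaves exactly the integral
   of [k], whose coefficients are oscillations of [F] and [G], at most [e]. *)
pose k t := (F z - F t) * g t + (G y - G t) * f t.
have lFg : locint (fun t => F t * g t) by exact: locintM.
have lGf : locint (fun t => G t * f t) by exact: locintM.
have l1 := locintZ (F z) lg; have l2 := locintZ (G y) lf.
have lk : locint k.
  apply: (eq_locint _ (locintD (locintD l1 l2) (locintZ (-1) (locintD lFg lGf)))).
  by move=> t; rewrite /k; ring.
have -> : F z * G z - F y * G y - \int[mu]_(t in `[y, z]) (F t * g t + G t * f t)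
  = \int[mu]_(t in `[y, z]) k t.
  have -> : F z * G z - F y * G y = F z * (G z - G y) + G y * (F z - F y) by ring.
  rewrite Gg// Ff// -!RintegralZl// -RintegralD//.
  rewrite -RintegralB; [|by []|exact: locintD|exact: locintD].
  by apply: eq_Rintegral => t _; rewrite /k; ring.
apply: le_trans (le_normr_Rintegral _ (lk y z)) _ => //.
have lfg : locint (fun t => `|f t| + `|g t|).
  by apply: locintD; exact: locint_norm.
rewrite -RintegralZl//.
apply: le_Rintegral => //.
- exact: (locint_norm lk).
- exact: (locintZ e lfg).
move=> t /=; rewrite in_itv/= => tyz; rewrite /k.
have h1 : `|F z - F t| <= e.
  have -> : F z - F t = (F x - F t) - (F x - F z) by ring.
  apply: le_trans (ler_normB _ _) _.
  have := nF t tyz; have := nF z; rewrite yz lexx => /(_ isT); lra.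
have h2 : `|G y - G t| <= e.
  have -> : G y - G t = (G x - G t) - (G x - G y) by ring.
  apply: le_trans (ler_normB _ _) _.
  have := nG t tyz; have := nG y; rewrite yz lexx => /(_ isT); lra.
apply: le_trans (ler_normD _ _) _; rewrite !normrM mulrDr addrC.
by apply: lerD; apply: ler_wpM2r.
Qed.

Lemma ACM F f G g : AC F f -> AC G g ->
  AC (fun x => F x * G x) (fun x => F x * g x + G x * f x).
Proof.
move=> ACF ACG.
have [cF cG] := (AC_continuous ACF, AC_continuous ACG).
have lh : locint (fun x => F x * g x + G x * f x).
  by apply: locintD; apply: locintM => //; [case: ACG | case: ACF].
split=> // a b ab; set I := \int[mu]_(x in _) _.
have lfg : locint (fun t => `|f t| + `|g t|).
  by apply: locintD; apply: locint_norm; [case: ACF | case: ACG].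
set m := \int[mu]_(t in `[a, b]) (`|f t| + `|g t|).
have m0 : 0 <= m by apply: Rintegral_ge0 => x _; exact: addr_ge0.
have H e : 0 < e -> `|F b * G b - F a * G a - I| <= e * m.
  move=> e0; pose P y z := `|F z * G z - F y * G y -
     \int[mu]_(t in `[y, z]) (F t * g t + G t * f t)| <=
     e * \int[mu]_(t in `[y, z]) (`|f t| + `|g t|).
  apply: (@segment_induction P a b ab).
    by move=> x _; have [d d0 H] := AC_local x e0 ACF ACG; exists d.
  move=> x y z xy yz; rewrite /P => Pxy Pyz.
  rewrite (Rintegral_itv_cat lh xy yz) (Rintegral_itv_cat lfg xy yz) mulrDr.
  apply: le_trans (lerD Pxy Pyz); apply: le_trans (ler_normD _ _).
  by rewrite le_eqVlt; apply/orP; left; apply/eqP; congr (`|_|); ring.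
apply/eqP; rewrite -subr_eq0 -normr_le0; apply/ler_addgt0Pr => e e0.
(* [m] may vanish, hence the division by [m + 1]. *)
rewrite add0r; have m1 : 0 < m + 1 by lra.
apply: le_trans (H (e / (m + 1)) _) _; first by apply: divr_gt0.
rewrite -mulrA ler_piMr ?(ltW e0)// mulrC ler_pdivrMr// mul1r; lra.
Qed.

Lemma ACZ F f c : AC F f -> AC (fun x => c * F x) (fun x => c * f x).
Proof.
move=> h; apply: AC_eq (ACM (AC_cst c) h) => // x; ring.
Qed.

End AbsolutelyContinuous.

(** * Integrals over the real line *)

Section Integrals.
Variable R : realType.
Local Notation mu := (@lebesgue_measure R).
Implicit Types (f g h F G : R -> R) (a b c d e x y z t r s : R).

(** [Rintegral] alone returns a default value on a non-integrable function; carrying integrability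
    along with the value lets identities between integrands pass to the values. *)
Definition hasI f r :=
  mu.-integrable setT (EFin \o f) /\ \int[mu]_x f x = r.

Definition sqI f := measurable_fun setT f /\ mu.-integrable setT (EFin \o (fun x => f x ^+ 2)).

Lemma hasI_unique f r s : hasI f r -> hasI f s -> r = s.
Proof. by move=> [_ <-] [_ <-]. Qed.

Lemma integrable_hasI f : mu.-integrable setT (EFin \o f) -> hasI f (\int[mu]_x f x).
Proof. by []. Qed.

Lemma eq_hasI f g r : f =1 g -> hasI f r -> hasI g r.
Proof. by move=> /funext ->. Qed.

Lemma eq_integrableT f g : f =1 g ->
  mu.-integrable setT (EFin \o f) -> mu.-integrable setT (EFin \o g).
Proof. by move=> /funext ->. Qed.

Lemma hasID f g r s : hasI f r -> hasI g s -> hasI (fun x => f x + g x) (r + s).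
Proof.
move=> [If <-] [Ig <-]; split; first exact: (integrableD _ If Ig).
by rewrite RintegralD.
Qed.

Lemma hasIZ f r c : hasI f r -> hasI (fun x => c * f x) (c * r).
Proof.
move=> [If <-]; split; first exact: (integrableZl _ c If).
by rewrite RintegralZl.
Qed.

Lemma hasIB f g r s : hasI f r -> hasI g s -> hasI (fun x => f x - g x) (r - s).
Proof.
move=> hf hg; have := hasID hf (hasIZ (-1) hg); rewrite mulN1r.
by apply: eq_hasI => x; rewrite mulN1r.
Qed.

Lemma hasI_le f g r s : (forall x, f x <= g x) -> hasI f r -> hasI g s -> r <= s.
Proof. by move=> fg [If <-] [Ig <-]; apply: le_Rintegral. Qed.

Lemma hasI_ge0 f r : (forall x, 0 <= f x) -> hasI f r -> 0 <= r.
Proof. by move=> f0 [If <-]; apply: Rintegral_ge0. Qed.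

Lemma hasI_norm f r : hasI f r -> hasI (fun x => `|f x|) (\int[mu]_x `|f x|).
Proof. by move=> [If _]; apply: integrable_hasI; exact: integrable_norm. Qed.

Lemma hasI_meas f r : hasI f r -> measurable_fun setT f.
Proof. by move=> [If _]; apply/measurable_EFinP; exact: (measurable_int mu If). Qed.

Lemma hasI_integral f r : hasI f r -> (\int[mu]_x (f x)%:E = r%:E)%E.
Proof. by move=> [If <-]; rewrite /Rintegral fineK//; exact: integrable_fin_num. Qed.

Lemma integral_hasI f r : mu.-integrable setT (EFin \o f) ->
  (\int[mu]_x (f x)%:E = r%:E)%E -> hasI f r.
Proof. by move=> If E; split=> //; rewrite /Rintegral E. Qed.

Lemma integrable_le f g : measurable_fun setT f ->
  (forall x, `|f x| <= g x) -> mu.-integrable setT (EFin \o g) ->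
  mu.-integrable setT (EFin \o f).
Proof.
move=> mf fg Ig; apply: (le_integrable _ _ _ Ig) => //.
  exact/measurable_EFinP.
move=> x _ /=; rewrite lee_fin; apply: le_trans (fg x) _; exact: ler_norm.
Qed.

Lemma hasI_patch f (A : set R) : measurable A -> mu.-integrable A (EFin \o f) ->
  hasI (f \_ A) (\int[mu]_(x in A) f x).
Proof.
move=> mA If; split; last by rewrite -Rintegral_mkcond.
rewrite -restrict_EFin.
exact: (proj1 (@integrable_mkcond _ _ R mu A (EFin \o f) mA) If).
Qed.

Lemma hasI_restrict f (A : set R) : measurable A ->
  mu.-integrable setT (EFin \o f) -> hasI (f \_ A) (\int[mu]_(x in A) f x).
Proof. by move=> mA If; apply: hasI_patch => //; exact: integrableS If. Qed.

Lemma integrable_locint f : mu.-integrable setT (EFin \o f) -> locint f.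
Proof. by move=> If a b; apply: integrableS If. Qed.

Lemma hasI_ae f g r : measurable_fun setT g -> ae_eq mu setT f g ->
  hasI f r -> hasI g r.
Proof.
move=> mg fg [If <-].
have fg' : ae_eq mu setT (EFin \o f) (EFin \o g).
  by apply: filterS fg => x /= /(_ Logic.I) ->.
have mf := measurable_int mu If.
have mg' : measurable_fun setT (EFin \o g) by exact/measurable_EFinP.
split.
  apply/integrableP; split => //.
  move/integrableP : If => [_]; congr (_ < _)%E.
  apply: ae_eq_integral => //; [exact: measurableT_comp..|].
  by apply: filterS fg => x /= /(_ Logic.I) ->.
rewrite /Rintegral; congr fine; apply: ae_eq_integral => //.
by apply: filterS fg => x /= /(_ Logic.I) ->.
Qed.

Lemma integral_segments f : (forall x, 0 <= f x) -> measurable_fun setT f ->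
  (\int[mu]_(x in `[(- n%:R)%R, n%:R]) (f x)%:E @[n --> \oo] -->
    \int[mu]_x (f x)%:E)%E.
Proof.
move=> f0 mf.
have UE : \bigcup_n `[(- n%:R), n%:R]%classic = [set: R].
  apply/seteqP; split => // x _ /=.
  exists (Num.bound `|x|) => //=; rewrite in_itv/= -ler_norml.
  by rewrite ltW// archi_boundP//.
rewrite -[X in _ --> (\int[mu]_(x in X) _)%E]UE.
pose A n : set (measurableTypeR R) := `[(- n%:R : R), n%:R]%classic.
apply: (@ge0_nondecreasing_set_cvg_integral _ _ R A (EFin \o f) mu) => //.
- move=> m n mn; apply/subsetPset => x; rewrite /A /= !in_itv/= => /andP[h1 h2].
  have : (m%:R : R) <= n%:R by rewrite ler_nat.
  by move=> h; apply/andP; split; lra.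
- by move=> i; exact: measurable_itv.
- by move=> i; apply/measurable_EFinP; exact: measurable_funTS.
- by move=> i x _; rewrite /= lee_fin.
Qed.

(** Monotone convergence. Square integrability of [Q] and of the solutions of the adjoint equation
    is obtained through this criterion. *)
Lemma integrable_bounded_segments f c : (forall x, 0 <= f x) ->
  measurable_fun setT f -> locint f ->
  (forall n : nat, \int[mu]_(x in `[- n%:R, n%:R]) f x <= c) ->
  mu.-integrable setT (EFin \o f) /\ \int[mu]_x f x <= c.
Proof.
move=> f0 mf lf fc.
have H := integral_segments f0 mf.
have le : (\int[mu]_x (f x)%:E <= c%:E)%E.
  rewrite -(cvg_lim _ H)//; apply: lime_le; first by apply/cvg_ex; eexists; exact: H.
  apply: nearW => n; have := fc n; rewrite -lee_fin /Rintegral fineK//.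
  exact: integrable_fin_num.
split; last first.
  rewrite -lee_fin /Rintegral fineK// ge0_fin_numE.
    by apply: le_lt_trans le _; rewrite ltry.
  by apply: integral_ge0 => x _; rewrite lee_fin.
apply/integrableP; split; first exact/measurable_EFinP.
under eq_integral do rewrite /= ger0_norm//.
by apply: le_lt_trans le _; rewrite ltry.
Qed.

(** The tail of |f| outside [-N, N] dominates the error of every larger segment, so [a] and [b] can
    move independently. *)
Lemma Rintegral_exhaust f e : mu.-integrable setT (EFin \o f) -> 0 < e ->
  exists N : R, 0 <= N /\ forall a b, a <= - N -> N <= b ->
    `|\int[mu]_x f x - \int[mu]_(x in `[a, b]) f x| <= e.
Proof.
move=> If e0.
have [Inf _] := hasI_norm (integrable_hasI If).
have mn : measurable_fun setT (fun x => `|f x|).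
  exact: hasI_meas (integrable_hasI Inf).
have n0 x : 0 <= `|f x| by [].
have := integral_segments n0 mn.
have fI : (\int[mu]_x `|f x|%:E)%E = (\int[mu]_x `|f x|)%:E.
  by rewrite (hasI_integral (integrable_hasI Inf)).
rewrite fI => /fine_cvgP[_] /cvgrPdist_lt /(_ _ e0) [N _ HN].
exists N%:R; split; first by rewrite ler0n.
move=> a b aN bN.
set A := `[a, b]%classic; set B := `[(- N%:R), N%:R]%classic : set R.
have BA : B `<=` A.
  by move=> x; rewrite /A /B /= !in_itv/= => /andP[? ?]; apply/andP; split; lra.
have [hA hB] : measurable A /\ measurable B by split; exact: measurable_itv.
have fA := hasI_restrict hA If; have nA := hasI_restrict hA Inf.
have nB := hasI_restrict hB Inf.
have h1 := hasIB (integrable_hasI If) fA.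
have h2 := hasIB (integrable_hasI Inf) nA.
have h3 := hasIB (integrable_hasI Inf) nB.
set IB := \int[mu]_(x in B) `|f x| in nB h3.
have hN : `|\int[mu]_x `|f x| - IB| < e by exact: HN N (leqnn N).
apply: le_trans (ltW hN); apply: le_trans (ler_norm _).
have l23 : \int[mu]_x `|f x| - \int[mu]_(x in A) `|f x| <= \int[mu]_x `|f x| - IB.
  apply: hasI_le h2 h3 => x; rewrite !patchE.
  case: ifPn => [xA|xA]; first by case: ifPn => _ //; rewrite subr0 subrr.
  by rewrite ifN//; apply: contra xA; rewrite !inE; exact: BA.
apply: le_trans l23; rewrite ler_norml; apply/andP; split.
  rewrite lerNl -mulN1r; apply: hasI_le (hasIZ (-1) h1) h2 => x; rewrite !patchE.
  case: ifPn => _; rewrite ?subrr ?mulr0// !subr0 mulN1r.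
  by rewrite -normrN; exact: ler_norm.
apply: hasI_le h1 h2 => x; rewrite !patchE.
by case: ifPn => _; rewrite ?subrr// !subr0; exact: ler_norm.
Qed.

(** An integrable function need not tend to 0, but it is small somewhere in each window of fixed
    length N = (I + 1) / e: otherwise that window alone would contribute I + 1 to the integral I of
    |f|. *)
Lemma integrable_small f e : mu.-integrable setT (EFin \o f) -> 0 < e ->
  exists N : R, 0 <= N /\ forall a, exists2 x, a <= x <= a + N & `|f x| < e.
Proof.
move=> If e0.
have [Inf _] := hasI_norm (integrable_hasI If).
set I := \int[mu]_x `|f x|.
have I0 : 0 <= I by apply: Rintegral_ge0.
have N0 : 0 <= (I + 1) / e by apply: divr_ge0; lra.
exists ((I + 1) / e); split => // a; apply: contrapT => H.
have Hx x : a <= x <= a + (I + 1) / e -> e <= `|f x|.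
  by move=> xa; rewrite leNgt; apply/negP => fx; apply: H; exists x.
set A := `[a, a + (I + 1) / e]%classic.
have mA : measurable A by exact: measurable_itv.
have : I + 1 <= I.
  have -> : I + 1 = \int[mu]_(x in A) e.
    rewrite Rintegral_cst//= lebesgue_measure_itv /= lte_fin.
    case: ifPn => [_|]; first by rewrite /= addrAC subrr add0r mulrC divfK// gt_eqF.
    rewrite -leNgt gerDl => h; have : 0 < (I + 1) / e by apply: divr_gt0; lra.
    lra.
  have ce : locint (fun=> e) by apply: continuous_locint; exact: cst_continuous.
  apply: (@le_trans _ _ (\int[mu]_(x in A) `|f x|)).
    apply: le_Rintegral => //; first exact: ce.
      exact: (integrable_locint Inf).
  apply: hasI_le (hasI_restrict mA Inf) (integrable_hasI Inf) => x.
  by rewrite patchE; case: ifPn => _; [exact: lexx | exact: normr_ge0].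
by rewrite gerDl ler10.
Qed.

(* The primitive has limits at both infinities, and these vanish because it is integrable. *)
Lemma AC_hasI0 F f : AC F f -> mu.-integrable setT (EFin \o F) ->
  mu.-integrable setT (EFin \o f) -> hasI f 0.
Proof.
move=> [_ Ff] IF If; split => //; apply/eqP; rewrite -normr_le0.
apply/ler_addgt0Pr => e e0; rewrite add0r.
have e3 : 0 < e / 3 by lra.
have [N [N0 HN]] := Rintegral_exhaust If e3.
have [M [M0 HM]] := integrable_small IF e3.
have [b /andP[Nb _] Fb] := HM N.
have [a /andP[_ aN] Fa] := HM (- N - M).
have := HN a b; rewrite -Ff; last lra.
have aN' : a <= - N by lra.
move=> /(_ aN' Nb).
move: Fb Fa; rewrite !ltr_norml !ler_norml => /andP[? ?] /andP[? ?] /andP[? ?].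
by apply/andP; split; lra.
Qed.

Lemma hasI_opp f r : hasI f r -> hasI (fun x => f (- x)) r.
Proof.
move=> hf; have mf := hasI_meas hf; have [If fr] := hf.
have IE g : measurable_fun setT g -> (forall x, 0 <= g x) ->
    (\int[mu]_x (g x)%:E = \int[mu]_x (g (- x))%:E)%E.
  move=> mg g0.
  have := @ge0_integral_pushforward _ _ (measurableTypeR R) (measurableTypeR R) R
    -%R (@oppr_measurable R setT) mu setT (EFin \o g).
  rewrite preimage_setT => <-//.
  - by apply/esym/eq_measure_integral => A mA _; exact: lebesgue_measureN.
  - exact/measurable_EFinP.
  - by move=> x _; rewrite lee_fin.
have mfo : measurable_fun setT (fun x => f (- x)).
  exact: (measurableT_comp mf (@oppr_measurable R setT)).
have Ifo : mu.-integrable setT (EFin \o (fun x => f (- x))).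
  apply/integrableP; split; first exact/measurable_EFinP.
  move/integrableP : If => [_].
  by rewrite (IE (fun x => `|f x|))//; exact: measurableT_comp.
apply: integral_hasI => //; rewrite -(hasI_integral hf).
have := @integral_pushforward _ _ (measurableTypeR R) (measurableTypeR R) R
    -%R (@oppr_measurable R setT) mu setT (EFin \o f).
rewrite preimage_setT => <-//.
- by apply/eq_measure_integral => A mA _; exact: lebesgue_measureN.
- exact/measurable_EFinP.
Qed.

Lemma hasI_odd f r : (forall x, f (- x) = - f x) -> hasI f r -> r = 0.
Proof.
move=> fo hf; have h : hasI f (- r).
  have := hasIZ (-1) (hasI_opp hf); rewrite mulN1r.
  by apply: eq_hasI => x; rewrite fo mulN1r opprK.
have := hasI_unique hf h; lra.
Qed.

Lemma sqIM f g : sqI f -> sqI g -> mu.-integrable setT (EFin \o (fun x => f x * g x)).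
Proof.
move=> [mf If] [mg Ig].
apply: (integrable_le _ _ (hasID (integrable_hasI If) (integrable_hasI Ig)).1).
  exact: measurable_funM.
move=> x; rewrite normrM -[f x ^+ 2]real_normK ?num_real//.
rewrite -[g x ^+ 2]real_normK ?num_real//.
move: (normr_ge0 (f x)) (normr_ge0 (g x)); nra.
Qed.

Lemma sqID f g : sqI f -> sqI g -> sqI (fun x => f x + g x).
Proof.
move=> sf sg; have [[mf If] [mg Ig]] := (sf, sg); split; first exact: measurable_funD.
have h := hasID (hasID (integrable_hasI If) (integrable_hasI Ig))
                (hasIZ 2 (integrable_hasI (sqIM sf sg))).
by apply: eq_integrableT h.1 => x; ring.
Qed.

Lemma sqI_bounded f h c : measurable_fun setT h -> (forall x, `|h x| <= c) ->
  sqI f -> sqI (fun x => h x * f x).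
Proof.
move=> mh hc [mf If]; split; first exact: measurable_funM.
apply: (integrable_le _ _ (hasIZ (c ^+ 2) (integrable_hasI If)).1).
  by apply: (measurable_funX 2); exact: measurable_funM.
move=> x; rewrite exprMn normrM [`|f x ^+ 2|]ger0_norm ?sqr_ge0//.
apply: ler_wpM2r; first exact: sqr_ge0.
by rewrite normrX lerXn2r ?nnegrE// (le_trans _ (hc x)).
Qed.

Lemma sqIZ f c : sqI f -> sqI (fun x => c * f x).
Proof. by apply: sqI_bounded => //. Qed.

Lemma integrable_bounded f h c : measurable_fun setT h -> (forall x, `|h x| <= c) ->
  mu.-integrable setT (EFin \o f) -> mu.-integrable setT (EFin \o (fun x => h x * f x)).
Proof.
move=> mh hc If; have hf := integrable_hasI If.
apply: (integrable_le _ _ (hasIZ c (hasI_norm hf)).1).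
  by apply: measurable_funM => //; exact: hasI_meas hf.
by move=> x; rewrite normrM; apply: ler_wpM2r.
Qed.

End Integrals.

(** * A smooth bump function *)

Section Bump.
Variable R : realType.
Local Notation mu := (@lebesgue_measure R).
Implicit Types (p : {poly R}) (k n : nat) (f g F G : R -> R) (a b c h x y z M : R).

Definition smooth f := forall n x, derivable (derive1n n f) x 1.

Lemma smooth_primitive F f : (forall x, is_derive x 1 F (f x)) -> smooth f -> smooth F.
Proof.
move=> dF sf n x; case: n => [|n].
  by have := dF x; case.
have E : derive1 F = f by apply/funext => y; rewrite derive1E; have := dF y; case.
rewrite /derive1n iterSr E; exact: sf.
Qed.

Lemma smoothB f g : smooth f -> smooth g -> smooth (f - g).
Proof.
move=> sf sg n x; suff -> : derive1n n (f - g) = derive1n n f - derive1n n g.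
  by apply: derivableB; [exact: sf | exact: sg].
elim: n => [//|n IH]; rewrite !derive1nS IH; apply/funext => y.
by rewrite derive1E deriveB ?fctE -?derive1E//.
Qed.

Lemma is_derive_affine f h a x y :
  is_derive (h * (x - a)) 1 f y -> is_derive x 1 (fun x => f (h * (x - a))) (h * y).
Proof.
move=> df; have d1 : is_derive x 1 (fun x : R => h * (x - a)) h.
  have -> : (fun x : R => h * (x - a)) = h *: (id - cst a) by [].
  by apply: is_derive_eq; rewrite subr0 /GRing.scale/= mulr1.
have -> : h * y = y * h by ring.
exact: (@is_derive1_comp R f (fun x => h * (x - a))).
Qed.

Lemma smooth_affine f h a : smooth f -> smooth (fun x => f (h * (x - a))).
Proof.
move=> sf n x.
have E : derive1n n (fun x => f (h * (x - a))) =
    fun x => h ^+ n * derive1n n f (h * (x - a)).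
  elim: n {x} => [|n IH]; first by apply/funext => x; rewrite expr0 mul1r.
  rewrite derive1nS IH; apply/funext => x.
  have D := is_derive_affine (derivableP (sf n (h * (x - a)))).
  have D2 := @is_deriveZ R R R _ (h ^+ n) x 1 _ D.
  rewrite derive1E derive_val derive1nS derive1E.
  by rewrite /GRing.scale /= exprSr mulrA.
rewrite E.
have D := is_derive_affine (derivableP (sf n (h * (x - a)))).
by have [] := @is_deriveZ R R R _ (h ^+ n) x 1 _ D.
Qed.

(** With the polynomial factor and the power of 1 / (1 - x^2) left free, this family is closed under
    differentiation, so smoothness follows by induction. *)
Definition bump p k x : R :=
  if `|x| < 1 then p.[x] * (1 - x ^+ 2)^-1 ^+ k.+1 * expR (- (1 - x ^+ 2)^-1)
  else 0.

Lemma expR_beats_power k y : 0 <= y -> y ^+ k.+1 * expR (- y) <= (k.+1)`!%:R.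
Proof.
move=> y0; rewrite expRN ler_pdivrMr ?expR_gt0// mulrC -ler_pdivrMr; last first.
  by rewrite ltr0n fact_gt0.
apply: le_trans (expR_ge1Dxn k y0); lra.
Qed.

Lemma sqr_lt1_sub x : `|x| < 1 -> 0 < 1 - x ^+ 2.
Proof. by rewrite ltr_norml => /andP[? ?]; nra. Qed.

(** Quadratic flatness at the points -1 and 1 is all that differentiability there requires. *)
Lemma bump_bound p k : exists2 c : R, 0 <= c & forall x, `|bump p k x| <= c * (1 - x ^+ 2) ^+ 2.
Proof.
have /compact_bounded[M0 [_ HM]] : compact (horner p @` `[(-1), 1]%classic).
  apply: continuous_compact (@segment_compact R (-1) 1).
  by apply: continuous_subspaceT; exact: continuous_horner.
pose M := `|M0| + 1.
have M0' : 0 <= M by apply: addr_ge0.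
have pM x : `|x| < 1 -> `|p.[x]| <= M.
  move=> x1; apply: HM; first by rewrite /M (le_lt_trans (ler_norm _))// ltrDl.
  by exists x => //=; rewrite in_itv/=; move: x1; rewrite ltr_norml => /andP[? ?];
    apply/andP; split; lra.
exists (M * (k.+3)`!%:R); first by apply: mulr_ge0 => //; rewrite ler0n.
move=> x; rewrite /bump; case: ifPn => x1; last first.
  by rewrite normr0 mulr_ge0 ?sqr_ge0// mulr_ge0 ?ler0n.
have s0 := sqr_lt1_sub x1; set s := 1 - x ^+ 2.
have t0 : 0 <= s^-1 by rewrite invr_ge0 ltW.
rewrite -mulrA normrM -mulrA; apply: ler_pM => //; first exact: pM.
rewrite ger0_norm; last by rewrite mulr_ge0 ?exprn_ge0 ?expR_ge0.
(* The exponential absorbs two more powers of [s^-1] than are present, which releases the factor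
   [s ^+ 2]. *)
have -> : s^-1 ^+ k.+1 = s^-1 ^+ k.+3 * s ^+ 2.
  by rewrite -addn2 exprD -mulrA -exprMn mulVf ?gt_eqF// expr1n mulr1.
by rewrite mulrAC; apply: ler_wpM2r; [exact: sqr_ge0 | exact: expR_beats_power].
Qed.

Lemma is_derive_flat f x c : (forall y, `|f y| <= c * (y - x) ^+ 2) ->
  is_derive x 1 f 0.
Proof.
move=> fc; have c0 : 0 <= c.
  by have := fc (x + 1); rewrite addrAC subrr add0r expr1n mulr1; exact: le_trans.
have fx : f x = 0.
  by apply/eqP; rewrite -normr_le0; have := fc x; rewrite subrr expr0n/= mulr0.
(* At y = x the division by zero makes the slope 0, the correct value, since the slope is at most c
   |y - x| in absolute value. *)
apply/is_derive1_caratheodory; exists (fun y => f y / (y - x)); split.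
- move=> z; rewrite fx subr0; have [->|zx] := eqVneq z x.
    by rewrite fx mul0r mul0r.
  by rewrite divfK// subr_eq0.
- rewrite /prop_for /continuous_at fx mul0r.
  have H y : `|f y / (y - x)| <= c * `|y - x|.
    have [->|yx] := eqVneq y x; first by rewrite fx mul0r normr0 mulr_ge0.
    rewrite normrM normrV ?unitfE ?subr_eq0// ler_pdivrMr ?normr_gt0 ?subr_eq0//.
    by rewrite -mulrA -expr2 real_normK ?num_real.
  apply/cvgrPdist_le => /= e e0.
  have e1 : 0 < e / (c + 1) by apply: divr_gt0; lra.
  exists (e / (c + 1)) => //= y; rewrite /= distrC => yx.
  rewrite sub0r normrN; apply: le_trans (H y) _.
  have : `|y - x| * (c + 1) <= e by rewrite -ler_pdivlMr ?ltW//; lra.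
  move: (normr_ge0 (y - x)); nra.
- by rewrite fx mul0r.
Qed.

(** With v = 1 / (1 - x^2) and v' = 2 x v^2, this is the polynomial left after factoring v^(k+3)
    exp(-v) out of the derivative of p v^(k+1) exp(-v). *)
Definition bump_deriv p k : {poly R} :=
  p^`() * (1 - 'X ^+ 2) ^+ 2 + (2 * k.+1%:R)%:P * 'X * p * (1 - 'X ^+ 2)
  - 2%:P * 'X * p.

Lemma horner_bump_deriv p k x : (bump_deriv p k).[x] =
  p^`().[x] * (1 - x ^+ 2) ^+ 2 + 2 * k.+1%:R * x * p.[x] * (1 - x ^+ 2)
  - 2 * x * p.[x].
Proof. by rewrite /bump_deriv !hornerE. Qed.

Lemma is_derive_bump p k x : is_derive x 1 (bump p k) (bump (bump_deriv p k) k.+2 x).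
Proof.
have [x1|x1|x1] := ltgtP `|x| 1.
- have s0 := sqr_lt1_sub x1.
  have sn0 : 1 - x ^+ 2 != 0 by rewrite gt_eqF.
  pose iv := (fun y : R => (1 - y ^+ 2)^-1).
  have d1 : is_derive x 1 (fun y : R => 1 - y ^+ 2) (- (2 * x)).
    have -> : (fun y : R => 1 - y ^+ 2) = cst 1 - (id ^+ 2).
      by apply/funext => y; rewrite !fctE.
    by apply: is_derive_eq; rewrite /GRing.scale/=; ring.
  have d2 : is_derive x 1 iv (2 * x * (iv x) ^+ 2).
    apply: (is_derive_eq (@is_deriveV R (fun y : R => 1 - y ^+ 2) x _ 1 sn0 d1)).
    by rewrite /iv /GRing.scale/= exprVn; field.
  have d3 : is_derive x 1 (fun y => expR (- iv y)) (expR (- iv x) * - (2 * x * (iv x) ^+ 2)).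
    exact: (@is_derive1_comp R (@expR R) (fun y => - iv y)).
  have d4 : is_derive x 1 (horner p * iv ^+ k.+1 * (fun y => expR (- iv y)))
     (bump (bump_deriv p k) k.+2 x).
    apply: is_derive_eq.
    rewrite /bump x1 horner_bump_deriv !fctE -/(iv x).
    have -> : 1 - x ^+ 2 = (iv x)^-1 by rewrite /iv invrK.
    have : iv x != 0 by rewrite invr_eq0.
    have -> : iv x ^+ k.+3 = iv x ^+ 3 * iv x ^+ k by rewrite -exprD.
    rewrite [iv x ^+ k.+1]exprS /GRing.scale /=.
    set e := expR _; set v := iv x; set vk := _ ^+ k => v0.
    by field.
  apply: near_eq_is_derive d4.
  near=> y; rewrite /bump ifT.
    by rewrite !fctE.
  near: y; exists (1 - `|x|) => [|y]; rewrite /= ?subr_gt0// => xy.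
  have -> : y = x - (x - y) by ring.
  by apply: le_lt_trans (ler_normB _ _) _; lra.
- have -> : bump (bump_deriv p k) k.+2 x = 0 by rewrite /bump ltNge ltW.
  apply: (near_eq_is_derive _ (is_derive_cst (0 : R) x 1)).
  near=> y; rewrite /bump ifF//; apply/negbTE; rewrite -leNgt ltW//.
  near: y; exists (`|x| - 1) => [|y]; rewrite /= ?subr_gt0// => xy.
  have := ler_normD (x - y) y; rewrite subrK; lra.
- have x21 : x ^+ 2 = 1 by rewrite -[x ^+ 2]real_normK ?num_real// x1 expr1n.
  have -> : bump (bump_deriv p k) k.+2 x = 0 by rewrite /bump x1 ltxx.
  have [c c0 Hc] := bump_bound p k.
  (* Since x^2 = 1, (1 - y^2)^2 = (y - x)^2 (y + x)^2, and 4 bounds the last factor when |y| < 1. *)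
  apply: (@is_derive_flat _ _ (4 * c)) => y.
  have [y1|y1] := ltP `|y| 1; last first.
    by rewrite /bump ltNge y1 /= normr0; apply: mulr_ge0; [lra | exact: sqr_ge0].
  apply: le_trans (Hc y) _.
  have -> : 1 - y ^+ 2 = x ^+ 2 - y ^+ 2 by rewrite x21.
  have -> : (x ^+ 2 - y ^+ 2) ^+ 2 = (y - x) ^+ 2 * (y + x) ^+ 2 by ring.
  have h4 : (y + x) ^+ 2 <= 4.
    move: y1; rewrite ltr_norml => /andP[? ?].
    by have /eqP := x1; rewrite eqr_norml ler01 andbT => /orP[] /eqP ->; nra.
  have -> : 4 * c * (y - x) ^+ 2 = c * ((y - x) ^+ 2 * 4) by ring.
  by apply: ler_wpM2l => //; apply: ler_wpM2l; first exact: sqr_ge0.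
Unshelve. all: by end_near. Qed.

Lemma smooth_bump p k : smooth (bump p k).
Proof.
move=> n; suff [q [j ->]] : exists q j, derive1n n (bump p k) = bump q j.
  by move=> x; have [] := is_derive_bump q j x.
elim: n => [|n [q [j E]]]; first by exists p, k.
exists (bump_deriv q j), j.+2; rewrite derive1nS E; apply/funext => x.
by rewrite derive1E; have [_ ->] := is_derive_bump q j x.
Qed.

Lemma smooth_continuous f : smooth f -> continuous f.
Proof.
by move=> sf x; apply/differentiable_continuous/derivable1_diffP; exact: (sf 0 x).
Qed.

Lemma smooth_derive f : smooth f -> smooth (derive1 f).
Proof. by move=> sf n x; have := sf n.+1 x; rewrite /derive1n iterSr. Qed.

Lemma AC_smooth f : smooth f -> AC f (derive1 f).
Proof.
move=> sf; apply: AC_derive; last exact/smooth_continuous/smooth_derive.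
by move=> x; apply: DeriveDef; [exact: (sf 0 x) | rewrite derive1E].
Qed.

Lemma AC_primitive f : locint f -> exists F, AC F f.
Proof.
move=> lf.
exists (fun x => if 0 <= x then \int[mu]_(t in `[0, x]) f t
                 else - \int[mu]_(t in `[x, 0]) f t).
split=> // a b ab; case: ifPn => b0; case: ifPn => a0.
- by rewrite (Rintegral_itv_cat lf a0 ab) addrAC subrr add0r.
- by rewrite opprK addrC -Rintegral_itv_cat// ltW// ltNge.
- by move: b0; rewrite (le_trans a0 ab).
- have b0' : b <= 0 by rewrite ltW// ltNge.
  by rewrite (Rintegral_itv_cat lf ab b0'); ring.
Qed.

Lemma AC_is_derive F f x : AC F f -> {for x, continuous f} -> is_derive x 1 F (f x).
Proof.
move=> [lf Ff] cf.
have x1 : x < x + 1 by lra.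
have x2 : x - 1 < x by lra.
have [D1 D2] := @continuous_FTC1_closed R f (x - 1) x (x + 1) x1 (lf _ _) x2 cf.
have D : is_derive x 1 (fun y => F (x - 1) + \int[mu]_(t in `[x - 1, y]) f t) (f x).
  have D0 : is_derive x 1 (fun y => \int[mu]_(t in `[x - 1, y]) f t) (f x).
    by rewrite -D2 derive1E; exact: derivableP.
  rewrite -[f x]add0r.
  exact: (is_deriveD (is_derive_cst (F (x - 1)) x 1) D0).
apply: near_eq_is_derive D; near=> y; rewrite -Ff; first by rewrite addrC subrK.
near: y; exists 1 => //= y; rewrite /= ltr_norml => /andP[? ?]; lra.
Unshelve. all: by end_near. Qed.

Lemma hasI_support f a b : locint f -> (forall x, ~~ (a <= x <= b) -> f x = 0) ->
  hasI f (\int[mu]_(x in `[a, b]) f x).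
Proof.
move=> lf f0; have fE : f = f \_ `[a, b].
  apply/funext => x; rewrite patchE; case: ifPn => // xab; apply: f0.
  by move: xab; rewrite mem_setE in_itv.
split; last by rewrite [RHS]Rintegral_mkcond -fE.
rewrite {1}fE -restrict_EFin.
exact: (proj1 (@integrable_mkcond _ _ R mu `[a, b]%classic (EFin \o f) (measurable_itv _)) (lf a b)).
Qed.

Lemma expR_neg_le1 y : 0 <= y -> y * expR (- y) <= 1.
Proof.
move=> y0; have := expR_beats_power 0 y0; rewrite expr1.
by have -> : (1`!%:R : R) = 1 by [].
Qed.

Definition rho := bump 1 0.

Lemma rhoE x : `|x| < 1 -> rho x = (1 - x ^+ 2)^-1 * expR (- (1 - x ^+ 2)^-1).
Proof. by move=> x1; rewrite /rho /bump x1 hornerE mul1r expr1. Qed.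

Lemma rho_out x : 1 <= `|x| -> rho x = 0.
Proof. by move=> x1; rewrite /rho /bump ltNge x1. Qed.

Lemma rho_ge0 x : 0 <= rho x.
Proof.
have [x1|x1] := ltP `|x| 1; last by rewrite rho_out.
by rewrite rhoE// mulr_ge0 ?expR_ge0// invr_ge0 ltW// sqr_lt1_sub.
Qed.

Lemma rho_le1 x : rho x <= 1.
Proof.
have [x1|x1] := ltP `|x| 1; last by rewrite rho_out.
by rewrite rhoE// expR_neg_le1// invr_ge0 ltW// sqr_lt1_sub.
Qed.

Lemma continuous_rho : continuous rho.
Proof. exact/smooth_continuous/smooth_bump. Qed.

(** [Phi] is constant on each side of [-1, 1], so the difference of two translates is compactly
    supported. The mass [kappa] is not normalized; its positivity suffices. *)
Lemma mollifier_primitive : exists (Phi : R -> R) (kappa : R),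
  [/\ 0 < kappa, smooth Phi, (forall x, is_derive x 1 Phi (rho x)),
    (forall x, x <= - 1 -> Phi x = 0) & (forall x, 1 <= x -> Phi x = kappa)].
Proof.
have lr : locint rho by apply: continuous_locint; exact: continuous_rho.
have [F AF] := AC_primitive lr.
have dF x : is_derive x 1 F (rho x) by apply: AC_is_derive AF _; exact: continuous_rho.
pose Phi x := F x - F (- 1).
have dP x : is_derive x 1 Phi (rho x).
  rewrite -[rho x]subr0.
  exact: (is_deriveB (dF x) (is_derive_cst (F (- 1)) x 1)).
have [_ FE] := AF.
have F0 a b : a <= b -> (forall x, a <= x <= b -> rho x = 0) -> F b = F a.
  move=> ab r0; apply/eqP; rewrite -subr_eq0 FE//.
  rewrite (@eq_Rintegral _ _ R mu _ (cst 0)); first by rewrite Rintegral_cst//= mul0r.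
  by move=> x; rewrite mem_setE in_itv/= => /r0.
exists Phi, (F 1 - F (- 1)); split => //.
- have -> : F 1 - F (- 1) = \int[mu]_(x in `[(-1), 1]) rho x by rewrite FE//; lra.
  have h1 : -1 <= - 2^-1 :> R by lra.
  have h2 : - 2^-1 <= 2^-1 :> R by lra.
  have h3 : 2^-1 <= 1 :> R by lra.
  have h4 : - 2^-1 <= 1 :> R by lra.
  rewrite (Rintegral_itv_cat lr h1 h4) (Rintegral_itv_cat lr h2 h3).
  have p1 : 0 <= \int[mu]_(x in `[(-1), (- 2^-1)]) rho x.
    by apply: Rintegral_ge0 => x _; exact: rho_ge0.
  have p2 : 0 <= \int[mu]_(x in `[2^-1, 1]) rho x.
    by apply: Rintegral_ge0 => x _; exact: rho_ge0.
  rewrite ltr_wpDl// ltr_wpDr//.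
  (* For |x| <= 1/2 the quantity v = 1 / (1 - x^2) lies in [1, 2], hence v exp(-v) >= exp(-2). *)
  have : \int[mu]_(x in `[(- 2^-1), 2^-1]) expR (- 2) <= \int[mu]_(x in `[(- 2^-1), 2^-1]) rho x.
    apply: le_Rintegral => //.
      exact: (continuous_locint (@cst_continuous _ _ _)).
    move=> x /=; rewrite in_itv/= => /andP[xa xb].
    have x1 : `|x| < 1 by rewrite ltr_norml; apply/andP; split; lra.
    have s0 := sqr_lt1_sub x1; rewrite rhoE//.
    have s1 : 1 <= (1 - x ^+ 2)^-1 by rewrite -[1]invr1 lef_pV2 ?posrE//; nra.
    have s2 : (1 - x ^+ 2)^-1 <= 2.
      by rewrite -[2]invrK lef_pV2 ?posrE ?invr_gt0//; nra.
    apply: (@le_trans _ _ (1 * expR (- (1 - x ^+ 2)^-1))).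
      by rewrite mul1r ler_expR lerN2.
    by rewrite ler_pM2r ?expR_gt0.
  apply: lt_le_trans; rewrite Rintegral_cst//= lebesgue_measure_itv /= lte_fin.
  by rewrite ifT /=; [apply: mulr_gt0; [exact: expR_gt0 | lra] | lra].
- apply: smooth_primitive dP _; exact: smooth_bump.
- move=> x x1; rewrite /Phi (F0 x (-1))// ?subrr// => y /andP[_ y1].
  by rewrite rho_out// ler0_norm; lra.
- move=> x x1; rewrite /Phi (F0 1 x)// => y /andP[y1 _].
  by rewrite rho_out// ger0_norm; lra.
Qed.

End Bump.

(** * Weak derivatives *)

Section DuBoisReymond.
Variable R : realType.
Local Notation mu := (@lebesgue_measure R).
Implicit Types (f g z : R -> R) (a b c h x y r s e kappa : R).

Definition mollifier h a x : R := h^-1 * rho (h^-1 * (x - a)).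

Lemma mollifier_out h a x : 0 < h -> ~~ (a - h < x < a + h) -> mollifier h a x = 0.
Proof.
move=> h0 xah; rewrite /mollifier rho_out ?mulr0//.
rewrite normrM normrV ?unitfE ?gt_eqF// gtr0_norm// ler_pdivlMl// mulr1.
rewrite leNgt; apply: contra xah; rewrite ltr_norml => /andP[? ?].
by apply/andP; split; lra.
Qed.

Lemma mollifier_bounds h a x : 0 < h -> 0 <= mollifier h a x <= h^-1.
Proof.
move=> h0; have hV : 0 <= h^-1 by rewrite invr_ge0 ltW.
by rewrite /mollifier mulr_ge0 ?rho_ge0//= ler_piMr ?rho_le1.
Qed.

Lemma continuous_mollifier h a : continuous (mollifier h a).
Proof.
move=> x; apply: cvgM; first exact: cvg_cst.
apply: (@continuous_comp _ _ _ (fun x => h^-1 * (x - a)) (@rho R)).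
  by apply: cvgM; [exact: cvg_cst | apply: cvgB; [exact: cvg_id | exact: cvg_cst]].
exact: continuous_rho.
Qed.

(** A single mollifier has nonzero integral and so is not the derivative of a test function; the
    difference of two of equal mass is. *)
Lemma mollifier_test : exists kappa, 0 < kappa /\ forall h, 0 < h ->
  (forall a, hasI (mollifier h a) kappa) /\
  (forall a b, exists2 phi, test_fun phi &
     forall x, derive1 phi x = mollifier h a x - mollifier h b x).
Proof.
have [Phi [kappa [k0 sP dP P0 P1]]] := @mollifier_primitive R.
exists kappa; split => // h h0.
have hV : h^-1 * h = 1 by rewrite mulVf ?gt_eqF.
have hV0 : 0 < h^-1 by rewrite invr_gt0.
have dm a x : is_derive x 1 (fun x => Phi (h^-1 * (x - a))) (mollifier h a x).
  exact: is_derive_affine.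
split => [a|a b].
  have AP := AC_derive (dm a) (@continuous_mollifier h a).
  have [lm FE] := AP.
  have aah : a - h <= a + h by lra.
  have <- : \int[mu]_(x in `[a - h, a + h]) mollifier h a x = kappa.
    rewrite -FE//; have -> : h^-1 * (a + h - a) = 1 by rewrite addrAC subrr add0r.
    have -> : h^-1 * (a - h - a) = -1 by rewrite addrAC subrr add0r mulrN hV.
    by rewrite P1// P0// subr0.
  apply: hasI_support => // x xah; apply: mollifier_out => //.
  by apply: contra xah => /andP[? ?]; apply/andP; split; exact: ltW.
exists ((fun x => Phi (h^-1 * (x - a))) - (fun x => Phi (h^-1 * (x - b)))).
  split; first by apply: smoothB; exact: smooth_affine.
  exists (`|a| + `|b| + h) => x xM; rewrite !fctE.
  have := ler_norm a; have := ler_norm b; have := ler_norm (- a); have := ler_norm (- b).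
  rewrite !normrN => hb1 ha1 hb2 ha2.
  have na := normr_ge0 a; have nb := normr_ge0 b.
  have [x0|x0] := leP 0 x.
    move: xM; rewrite (ger0_norm x0) => xM.
    by rewrite !P1 ?subrr// ler_pdivlMl// mulr1; lra.
  move: xM; rewrite (ltr0_norm x0) => xM.
  by rewrite !P0 ?subrr// ler_pdivrMl// mulrN1; lra.
move=> x; rewrite derive1E.
by have [_ ->] := is_deriveB (dm a x) (dm b x).
Qed.

Lemma locint_locally_integrable z : measurable_fun setT z -> locint z ->
  locally_integrable setT z.
Proof.
move=> mz lz; split => //; first exact: openT.
move=> K _ cK; have [M [_ HM]] := compact_bounded cK.
have KM : K `<=` `[- (`|M| + 1), `|M| + 1]%classic.
  move=> x Kx; rewrite /= in_itv/= -ler_norml; apply: HM => //.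
  by rewrite (le_lt_trans (ler_norm _))// ltrDl.
have /integrableP[_] := lz (- (`|M| + 1)) (`|M| + 1).
apply: le_lt_trans; apply: ge0_subset_integral => //.
- exact: compact_measurable.
- exact/measurable_EFinP/measurableT_comp/measurable_funTS.
Qed.

(** The mollifier is at most 1 / h on a ball of length 2 h, so the error is at most twice the mean
    of |z - z a| over that ball, a quantity that tends to 0 at Lebesgue points. *)
Lemma mollified_error z h a kappa : measurable_fun setT z -> locint z -> 0 < h ->
  hasI (mollifier h a) kappa ->
  mu.-integrable setT (EFin \o (fun x => z x * mollifier h a x)) /\
  `|\int[mu]_x (z x * mollifier h a x) - z a * kappa| <= 2 * fine (davg z a h).
Proof.
move=> mz lz h0 hk.
have lzm : locint (fun x => z x * mollifier h a x).
  apply: eq_locint (locintM (@continuous_mollifier h a) lz) => x; exact: mulrC.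
have out x : ~~ (a - h <= x <= a + h) -> mollifier h a x = 0.
  move=> xah; apply: mollifier_out => //.
  by apply: contra xah => /andP[? ?]; apply/andP; split; exact: ltW.
have [Izm _] : hasI (fun x => z x * mollifier h a x)
    (\int[mu]_(x in `[a - h, a + h]) (z x * mollifier h a x)).
  by apply: hasI_support => // x /out ->; rewrite mulr0.
split => //.
have hd : hasI (fun x => (z x - z a) * mollifier h a x)
    (\int[mu]_x (z x * mollifier h a x) - z a * kappa).
  apply: eq_hasI (hasIB (integrable_hasI Izm) (hasIZ (z a) hk)) => x; ring.
have lza : locint (fun x => `|z x - z a|).
  apply: locint_norm; apply: locintD lz _.
  by apply: continuous_locint; exact: cst_continuous.
have mB : measurable (ball a h) by exact: measurable_ball.
have IB : mu.-integrable (ball a h) (EFin \o (fun x => `|z x - z a|)).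
  apply: integrableS (lza (a - h) (a + h)) => // x.
  rewrite /= /ball /= in_itv/= ltr_distlC => /andP[? ?].
  by apply/andP; split; exact: ltW.
have hB := hasIZ h^-1 (hasI_patch mB IB).
have -> : 2 * fine (davg z a h) = h^-1 * \int[mu]_(x in ball a h) `|z x - z a|.
  rewrite /davg /iavg lebesgue_measure_ball ?ltW//.
  have mB' : measurable (ball a h : set (measurableTypeR R)) by exact: mB.
  have := integrable_fin_num mB' IB.
  rewrite /Rintegral /=; set I := (\int[_]_(y in _) _)%E => fI.
  rewrite inver mulrn_eq0 (gt_eqF h0) /= -[in LHS](fineK fI) -EFinM /= mulr2n.
  by field; rewrite gt_eqF.
have hn := hasI_norm hd.
apply: (@le_trans _ _ (\int[mu]_x `|(z x - z a) * mollifier h a x|)).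
  have [Id <-] := hd; exact: le_normr_Rintegral.
apply: hasI_le hn hB => x; rewrite patchE normrM.
have /andP[m0 m1] := mollifier_bounds a x h0.
case: ifPn => xB.
  by rewrite mulrC ger0_norm// ler_wpM2r.
rewrite mollifier_out ?normr0 ?mulr0//.
apply: contra xB => xah; rewrite inE /ball /= ltr_distlC.
by move: xah => /andP[? ?]; apply/andP; split; lra.
Qed.

(* The mollified values at [a] and [b] agree, since their difference is tested by a
   derivative, and they converge to [z a] and [z b] at Lebesgue points. *)
Lemma du_bois_reymond z : measurable_fun setT z -> locint z ->
  (forall phi, test_fun phi -> hasI (fun x => z x * derive1 phi x) 0) ->
  exists c, ae_eq mu setT z (cst c).
Proof.
move=> mz lz H.
have [kappa [k0 Hk]] := mollifier_test.
have Lae := lebesgue_differentiation (locint_locally_integrable mz lz).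
have Leq a b : lebesgue_pt z a -> lebesgue_pt z b -> z a = z b.
  move=> La Lb.
  apply/eqP; rewrite -subr_eq0 -normr_le0; apply/ler_addgt0Pr => e e0; rewrite add0r.
  (* Each of the two errors is at most twice a mean below kappa e / 4; their sum stays below kappa
     e. *)
  have e1 : 0 < kappa * e / 4 by apply: divr_gt0; [exact: mulr_gt0 | lra].
  have /fine_cvgP[_ /cvgrPdist_lt /(_ _ e1) Ha] := La.
  have /fine_cvgP[_ /cvgrPdist_lt /(_ _ e1) Hb] := Lb.
  near (0 : R)^'+ => h.
  have h0 : 0 < h by [].
  have ha : `|0 - fine (davg z a h)| < kappa * e / 4 by near: h; exact: Ha.
  have hb : `|0 - fine (davg z b h)| < kappa * e / 4 by near: h; exact: Hb.
  have [hm ht] := Hk h h0.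
  have [Ia Ea] := mollified_error mz lz h0 (hm a).
  have [Ib Eb] := mollified_error mz lz h0 (hm b).
  have [phi tphi dphi] := ht a b.
  have E0 : \int[mu]_x (z x * mollifier h a x) - \int[mu]_x (z x * mollifier h b x) = 0.
    apply: hasI_unique (hasIB (integrable_hasI Ia) (integrable_hasI Ib)) _.
    apply: eq_hasI (H phi tphi) => x; rewrite dphi; ring.
  move: Ea Eb E0; set A := Rintegral _ _ _; set B := Rintegral _ _ _ => Ea Eb E0.
  rewrite -(@ler_pM2l _ kappa)// -[X in X * `|_|](gtr0_norm k0) -normrM.
  have -> : kappa * (z a - z b) = (B - z b * kappa) - (A - z a * kappa) + (A - B) by ring.
  rewrite E0 addr0; apply: le_trans (ler_normB _ _) _.
  move: ha hb; rewrite !sub0r !normrN => ha hb.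
  have := ler_norm (fine (davg z a h)); have := ler_norm (fine (davg z b h)); lra.
(* Because the line has positive measure, the almost-everywhere filter is proper and some Lebesgue
   point exists. *)
have muT : (0 < mu setT)%E.
  by rewrite -set_itvNyy lebesgue_measure_itv /= ltry.
have [a La] : exists a, lebesgue_pt z a.
  have := ae_properfilter_algebraOfSetsType muT => PF.
  exact: filter_ex Lae.
have FF := ae_filter_ringOfSetsType mu.
exists (z a); apply: (@filterS _ _ FF _ _ _ Lae) => x Lx _; exact: Leq.
Unshelve. all: by end_near. Qed.

Lemma L2_sqI f : L2 f -> sqI f.
Proof.
move=> [mf If]; split => //; apply/integrableP; split.
  by apply/measurable_EFinP; exact: (measurable_funX 2).
apply: le_lt_trans If; rewrite le_eqVlt; apply/orP; left; apply/eqP.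
by apply: eq_integral => x _ /=; rewrite ger0_norm// sqr_ge0.
Qed.

Lemma sqI_locint f : sqI f -> locint f.
Proof.
move=> [mf If] a b.
have l1 : locint (fun x => 1 + f x ^+ 2).
  apply: locintD; first by apply: continuous_locint; exact: cst_continuous.
  exact: integrable_locint.
apply: (le_integrable _ _ _ (l1 a b)) => //.
  by apply/measurable_EFinP; exact: measurable_funTS.
move=> x _ /=; rewrite lee_fin.
rewrite [leRHS]ger0_norm; last by rewrite addr_ge0 ?sqr_ge0.
by rewrite -[f x ^+ 2]real_normK ?num_real//; move: (normr_ge0 (f x)); nra.
Qed.

(** A primitive of [du] differs from [u] by a function with zero weak derivative, hence by a
    constant almost everywhere. *)
Lemma H1_AC u du : H1 u du -> exists U, AC U du /\ ae_eq mu setT u U.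
Proof.
move=> [/L2_sqI su [/L2_sqI sdu wd]].
have [mu_ _] := su; have lu := sqI_locint su; have ldu := sqI_locint sdu.
have [U0 AU0] := AC_primitive ldu.
have cU0 := AC_continuous AU0.
have mU0 : measurable_fun setT U0 by exact: continuous_measurable_fun.
have lU0 := continuous_locint cU0.
pose z x := u x - U0 x.
have lz : locint z.
  by apply: eq_locint (locintD lu (locintZ (-1) lU0)) => x; rewrite mulN1r.
have mz : measurable_fun setT z by exact: measurable_funB.
have [c zc] : exists c, ae_eq mu setT z (cst c).
  apply: du_bois_reymond => // phi tphi.
  have [sphi [M phiM]] := tphi.
  have Aphi := AC_smooth sphi.
  have cphi := smooth_continuous sphi.
  have cdphi := smooth_continuous (smooth_derive sphi).
  (* As M < N, [phi] vanishes for |x| >= N, in particular at the endpoints of [-N, N]. *)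
  pose N := `|M| + 1.
  have phi0 x : N <= `|x| -> phi x = 0.
    move=> xN; apply: phiM; apply: lt_le_trans xN.
    by rewrite (le_lt_trans (ler_norm _))// ltrDl.
  have dphi0 x : N < `|x| -> derive1 phi x = 0.
    move=> xN; have D0 : is_derive x 1 phi 0.
      apply: (near_eq_is_derive _ (is_derive_cst (0 : R) x 1)).
      near=> y; rewrite phi0//; near: y.
      exists (`|x| - N) => [|y]; rewrite /= ?subr_gt0// => xy.
      by have := ler_normD (x - y) y; rewrite subrK; lra.
    by rewrite derive1E; have [_ ->] := D0.
  have out x : ~~ (- N <= x <= N) -> N < `|x|.
    by rewrite -ler_norml -ltNge.
  have AUp := ACM AU0 Aphi.
  have [lUp EUp] := AUp.
  have hU : hasI (fun x => U0 x * derive1 phi x + phi x * du x) 0.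
    have NN : - N <= N by rewrite -subr_ge0 opprK /N !addr_ge0.
    have -> : 0 = \int[mu]_(x in `[- N, N]) (U0 x * derive1 phi x + phi x * du x).
      by rewrite -EUp// !phi0 ?normrN ?ler_norm// !mulr0 subrr.
    apply: hasI_support => // x /out xN.
    by rewrite phi0 ?dphi0 ?mulr0 ?mul0r ?addr0// ltW.
  have h1 := @hasI_support _ (fun x => derive1 phi x * u x) (- N) N (locintM cdphi lu).
  have h2 := @hasI_support _ (fun x => phi x * du x) (- N) N (locintM cphi ldu).
  have {}h1 : hasI (fun x => u x * derive1 phi x) (\int[mu]_(x in `[- N, N]) (derive1 phi x * u x)).
    apply: eq_hasI (h1 _) => [x|x /out xN]; first exact: mulrC.
    by rewrite dphi0// mul0r.
  have {}h2 : hasI (fun x => du x * phi x) (\int[mu]_(x in `[- N, N]) (phi x * du x)).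
    apply: eq_hasI (h2 _) => [x|x /out xN]; first exact: mulrC.
    by rewrite phi0 ?mul0r// ltW.
  move: h1 h2; set r1 := Rintegral _ _ _; set r2 := Rintegral _ _ _ => h1 h2.
  have r12 : r1 = - r2.
    have := wd phi tphi; rewrite (hasI_integral h1) (hasI_integral h2) -EFinN.
    by move=> [].
  have -> : 0 = r1 + r2 - 0 by rewrite r12 subr0 addNr.
  apply: eq_hasI (hasIB (hasID h1 h2) hU) => x; rewrite /z; ring.
exists (fun x => U0 x + c); split.
  by apply: AC_eq (ACD AU0 (AC_cst c)) => // x; rewrite addr0.
apply: filterS zc => x /= /(_ Logic.I); rewrite /z => zx _.
by rewrite -zx addrC subrK.
Unshelve. all: by end_near. Qed.

End DuBoisReymond.

(** * The soliton *)

Section Soliton.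
Variable R : realType.
Local Notation mu := (@lebesgue_measure R).
Implicit Types (f g : R -> R) (x y : R) (n : nat).

Definition th x : R := (expR (2 * x) - expR (- (2 * x))) / (expR (2 * x) + expR (- (2 * x))).

Let E x : R := expR (2 * x) + expR (- (2 * x)).

Let E_gt0 x : 0 < E x.
Proof. by apply: addr_gt0; exact: expR_gt0. Qed.

Let EE x : expR (2 * x) * expR (- (2 * x)) = 1 :> R.
Proof. exact: expRxMexpNx_1. Qed.

Lemma sech2E x : 1 - th x ^+ 2 = 4 / E x ^+ 2.
Proof.
have E0 : E x != 0 by rewrite gt_eqF.
have := EE x; rewrite /th -/(E x); move: E0; rewrite /E.
set a := expR _; set b := expR _ => ab0 ab.
(* Replacing 1 by the product of the two exponentials makes the identity homogeneous, so that it is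
   purely algebraic. *)
have -> : 4 = 4 * (a * b) by rewrite ab mulr1.
by field.
Qed.

Lemma th_lt1 x : th x ^+ 2 < 1.
Proof.
by rewrite -subr_gt0 sech2E; apply: divr_gt0 => //; exact: exprn_gt0.
Qed.

Lemma th_bounds x : -1 <= th x <= 1.
Proof. by have := th_lt1 x; nra. Qed.

Lemma norm_th x : `|th x| <= 1.
Proof. by rewrite ler_norml th_bounds. Qed.

Lemma thN x : th (- x) = - th x.
Proof. by rewrite /th mulrN opprK -[RHS]mulNr opprB; congr (_ / _); exact: addrC. Qed.

Lemma th_le0 x : x <= 0 -> th x <= 0.
Proof.
move=> x0; rewrite /th -/(E x) ler_pdivrMr// mul0r subr_le0 ler_expR; lra.
Qed.

Lemma th_gt0 x : 0 < x -> 0 < th x.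
Proof.
move=> x0; rewrite /th -/(E x) divr_gt0// subr_gt0 ltr_expR; lra.
Qed.

Let dexp2 x : is_derive x 1 (fun x => expR (2 * x)) (2 * expR (2 * x)).
Proof.
have d : is_derive x 1 (fun x : R => 2 * x) 2.
  have -> : (fun x : R => 2 * x) = 2 *: (id : R -> R) by [].
  by apply: is_derive_eq; rewrite /GRing.scale/= mulr1.
rewrite mulrC; exact: (@is_derive1_comp R expR (fun x => 2 * x)).
Qed.

Let dexpN2 x : is_derive x 1 (fun x => expR (- (2 * x))) (- 2 * expR (- (2 * x))).
Proof.
have d : is_derive x 1 (fun x : R => - (2 * x)) (- 2).
  have -> : (fun x : R => - (2 * x)) = (- 2) *: (id : R -> R).
    by apply/funext => y; rewrite fctE /GRing.scale/= mulNr.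
  by apply: is_derive_eq; rewrite /GRing.scale/= mulr1.
rewrite mulrC; exact: (@is_derive1_comp R expR (fun x => - (2 * x))).
Qed.

Lemma is_derive_th x : is_derive x 1 th (2 * (1 - th x ^+ 2)).
Proof.
have dE := is_deriveD (dexp2 x) (dexpN2 x).
have dS := is_deriveB (dexp2 x) (dexpN2 x).
have E0 : E x != 0 by rewrite gt_eqF.
have dV := @is_deriveV R E x _ 1 E0 dE.
apply: (is_derive_eq (is_deriveM dS dV)).
rewrite !fctE /GRing.scale/= sech2E; have := EE x; move: E0; rewrite /E.
set a := expR _; set b := expR _ => ab0 ab.
have -> : 4 = 4 * (a * b) by rewrite ab mulr1.
by field.
Qed.

Lemma continuous_th : continuous th.
Proof.
move=> x; apply/differentiable_continuous/derivable1_diffP.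
by have [] := is_derive_th x.
Qed.

Lemma AC_th : AC th (fun x => 2 * (1 - th x ^+ 2)).
Proof.
apply: AC_derive; first exact: is_derive_th.
move=> x; apply: cvgM; first exact: cvg_cst.
apply: cvgB; first exact: cvg_cst.
by apply: (@continuous_comp _ _ _ th (fun y => y ^+ 2)); [exact: continuous_th | exact: exprn_continuous].
Qed.

Lemma QE x : Q x = powR (3 * (1 - th x ^+ 2)) (1 / 4).
Proof.
rewrite /Q; congr powR; rewrite sech2E /cosh -/(E x).
by field; rewrite gt_eqF.
Qed.

Let w_gt0 x : 0 < 3 * (1 - th x ^+ 2).
Proof. by have := th_lt1 x; lra. Qed.

Lemma Q_gt0 x : 0 < Q x.
Proof. by rewrite QE powR_gt0. Qed.

Lemma Q4 x : Q x ^+ 4 = 3 * (1 - th x ^+ 2).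
Proof.
rewrite QE -powR_mulrn ?powR_ge0// -powRrM.
have -> : (1 / 4 * 4%:R : R) = 1 by field.
by rewrite powRr1// ltW.
Qed.

Lemma Q_le2 x : Q x <= 2.
Proof.
rewrite -(@ler_pXn2r _ 4)// ?nnegrE ?(ltW (Q_gt0 x))//.
by rewrite Q4; have := sqr_ge0 (th x); lra.
Qed.

Lemma QN x : Q (- x) = Q x.
Proof. by rewrite !QE thN sqrrN. Qed.

(** Q^4 is a multiple of 1 - th^2, whose logarithmic derivative is -4 th. This is the first-order
    equation A_1 Q = 0. *)
Lemma is_derive_Q x : is_derive x 1 (@Q R) (- (th x * Q x)).
Proof.
have dw : is_derive x 1 (fun x => 3 * (1 - th x ^+ 2)) (- 4 * th x * (3 * (1 - th x ^+ 2))).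
  have -> : (fun x => 3 * (1 - th x ^+ 2)) = 3 *: (cst 1 - th ^+ 2) by [].
  have := is_derive_th x => dT.
  by apply: is_derive_eq; rewrite /GRing.scale/=; ring.
have -> : @Q R = (fun y => powR (3 * (1 - th y ^+ 2)) (1 / 4)).
  by apply/funext => y; exact: QE.
have dp := @is_derive1_powR R (1 / 4) (3 * (1 - th x ^+ 2)) (w_gt0 x).
apply: (is_derive_eq (@is_derive1_comp R (fun y => powR y (1 / 4))
  (fun y => 3 * (1 - th y ^+ 2)) x _ _ dp dw)).
have p4 : (0 : R) < 1 / 4 by lra.
have := mulr_powRB1 (ltW (w_gt0 x)) p4.
set w := 3 * _; set p := powR w (1 / 4) => <-.
by field.
Qed.

Lemma continuous_Q : continuous (@Q R).
Proof.
move=> x; apply/differentiable_continuous/derivable1_diffP.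
by have [] := is_derive_Q x.
Qed.

Lemma dQE x : dQ x = - (th x * Q x).
Proof. by rewrite /dQ derive1E; have [_ ->] := is_derive_Q x. Qed.

Lemma continuous_QX n : continuous (fun x => @Q R x ^+ n).
Proof.
move=> x.
by apply: (@continuous_comp _ _ _ (@Q R) (fun y => y ^+ n)); [exact: continuous_Q | exact: exprn_continuous].
Qed.

Lemma is_derive_QX n x :
  is_derive x 1 (fun x => Q x ^+ n.+1) (- (n.+1%:R * th x * Q x ^+ n.+1)).
Proof.
have dQ := is_derive_Q x.
have -> : (fun x => Q x ^+ n.+1) = (@Q R) ^+ n.+1 by apply/funext => y; rewrite fctE.
apply: is_derive_eq.
by rewrite /GRing.scale/= exprS; ring.
Qed.

Lemma AC_QX n : AC (fun x => Q x ^+ n.+1) (fun x => - (n.+1%:R * th x * Q x ^+ n.+1)).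
Proof.
apply: AC_derive; first exact: is_derive_QX.
move=> x; apply: cvgN; apply: cvgM; last exact: continuous_QX.
by apply: cvgM; [exact: cvg_cst | exact: continuous_th].
Qed.

Lemma AC_QXV n :
  AC (fun x => (Q x ^+ n.+1)^-1) (fun x => n.+1%:R * th x * (Q x ^+ n.+1)^-1).
Proof.
have Q0 x : Q x ^+ n.+1 != 0 by rewrite expf_neq0// gt_eqF// Q_gt0.
apply: AC_derive => x.
  apply: (is_derive_eq (@is_deriveV R (fun x => Q x ^+ n.+1) x _ 1 (Q0 x) (is_derive_QX n x))).
  rewrite /GRing.scale/=.
  by field.
apply: cvgM; last by apply: cvgV => //; exact: continuous_QX.
by apply: cvgM; [exact: cvg_cst | exact: continuous_th].
Qed.

(* [Q^2 <= 2 sech^2 x], the derivative of the bounded function [2 tanh x]. *)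
Lemma sqI_Q : sqI (@Q R).
Proof.
have mQ : measurable_fun setT (@Q R) by apply: continuous_measurable_fun; exact: continuous_Q.
split => //.
(* [th (2^-1 * (x - 0))] is tanh x, written in the shape of [is_derive_affine]. *)
have dG x : is_derive x 1 (fun x => 2 * th (2^-1 * (x - 0))) (2 * (1 - th (2^-1 * (x - 0)) ^+ 2)).
  have D := is_derive_affine (is_derive_th (2^-1 * (x - 0))).
  apply: (is_derive_eq (@is_deriveZ R R R _ 2 x 1 _ D)).
  by rewrite /GRing.scale/=; field.
have cT : continuous (fun x => th (2^-1 * (x - 0))).
  move=> x; apply: (@continuous_comp _ _ _ (fun x => 2^-1 * (x - 0)) th).
    by apply: cvgM; [exact: cvg_cst | apply: cvgB; [exact: cvg_id | exact: cvg_cst]].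
  exact: continuous_th.
have [lG GE] : AC (fun x => 2 * th (2^-1 * (x - 0))) (fun x => 2 * (1 - th (2^-1 * (x - 0)) ^+ 2)).
  apply: AC_derive => // x; apply: cvgM; first exact: cvg_cst.
  apply: cvgB; first exact: cvg_cst.
  by apply: (@continuous_comp _ _ _ (fun x => th (2^-1 * (x - 0))) (fun y => y ^+ 2)); [exact: cT | exact: exprn_continuous].
have QG x : Q x ^+ 2 <= 2 * (1 - th (2^-1 * (x - 0)) ^+ 2).
  rewrite subr0 -(@ler_pXn2r _ 2)// ?nnegrE ?sqr_ge0//; last first.
    by have := th_lt1 (2^-1 * x); lra.
  have x2 : 2 * (2^-1 * x) = x by field.
  rewrite -exprM Q4 !sech2E /E x2.
  have e2 : expR (2 * x) = expR x ^+ 2 by rewrite -expRM_natl.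
  have eN2 : expR (- (2 * x)) = expR (- x) ^+ 2 by rewrite -expRM_natl mulrN.
  rewrite e2 eN2; have := expR_gt0 x; have := expR_gt0 (- x).
  set a := expR x; set b := expR (- x) => b0 a0.
  have -> : 3 * (4 / (a ^+ 2 + b ^+ 2) ^+ 2) = 12 * ((a ^+ 2 + b ^+ 2) ^+ 2)^-1 by ring.
  have ab0 : 0 < a ^+ 2 + b ^+ 2 by nra.
  have -> : (2 * (4 / (a + b) ^+ 2)) ^+ 2 = 64 * ((a + b) ^+ 4)^-1 by field; lra.
  rewrite ler_pdivrMr ?exprn_gt0// mulrAC ler_pdivlMr ?exprn_gt0//; last lra.
  (* With p = (a + b)^2 and q = a^2 + b^2 the claim is 12 p^2 <= 64 q^2, and p <= 2 q already gives
     48 q^2. *)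
  have h1 : 0 <= (a + b) ^+ 2 <= 2 * (a ^+ 2 + b ^+ 2).
    by rewrite sqr_ge0 /=; have := sqr_ge0 (a - b); nra.
  have -> : (a + b) ^+ 4 = ((a + b) ^+ 2) ^+ 2 by ring.
  move: h1; set p := (a + b) ^+ 2; set q := a ^+ 2 + b ^+ 2 => /andP[p0 pq].
  nra.
have lQ : locint (fun x => Q x ^+ 2) by apply: continuous_locint; exact: continuous_QX.
apply: (@integrable_bounded_segments R _ 4 _ _ lQ _).1.
- by move=> x; exact: sqr_ge0.
- exact: (measurable_funX 2).
move=> n; have nn : - n%:R <= n%:R :> R by have : (0 : R) <= n%:R by []; lra.
apply: (@le_trans _ _ (\int[mu]_(x in `[(- n%:R), n%:R]) (2 * (1 - th (2^-1 * (x - 0)) ^+ 2)))).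
  exact: le_Rintegral.
rewrite -GE//; have := th_bounds (2^-1 * (n%:R - 0)).
by have := th_bounds (2^-1 * (- n%:R - 0)); lra.
Qed.

End Soliton.

(** * The adjoint equation *)

Section HalfLine.
Variable R : realType.
Local Notation mu := (@lebesgue_measure R).
Implicit Types (f g h : R -> R) (a b x y r e M : R).

Lemma Rintegral_halflines h x : mu.-integrable setT (EFin \o h) ->
  \int[mu]_y h y = \int[mu]_(y in `]-oo, x]) h y + \int[mu]_(y in `[x, +oo[) h y.
Proof.
rewrite -set_itvNyy => Ih.
have := @Rintegral_itvB R h -oo%O +oo%O x Ih isT isT.
move/eqP; rewrite subr_eq => /eqP ->; rewrite addrC; congr (_ + _).
by apply: Rintegral_itv_obnd_cbnd; apply: integrableS Ih => //; exact: subset_itvNyy.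
Qed.

Lemma Rintegral_halfline_cat h a b : mu.-integrable setT (EFin \o h) -> a <= b ->
  \int[mu]_(y in `]-oo, b]) h y - \int[mu]_(y in `]-oo, a]) h y =
  \int[mu]_(y in `[a, b]) h y.
Proof.
move=> Ih ab.
have Ib : mu.-integrable `]-oo, b] (EFin \o h) by apply: integrableS Ih.
rewrite (@Rintegral_itvB R h -oo%O (BRight b) a)//.
apply: Rintegral_itv_obnd_cbnd; apply: integrableS Ih => //.
Qed.

Lemma Rintegral_halfline_opp h x : mu.-integrable setT (EFin \o h) ->
  \int[mu]_(y in `[x, +oo[) h y = \int[mu]_(y in `]-oo, - x]) h (- y).
Proof.
move=> Ih.
have h1 := hasI_opp (hasI_restrict (measurable_itv `[x, +oo[) Ih).
have Iho := (hasI_opp (integrable_hasI Ih)).1.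
have h2 := hasI_restrict (measurable_itv `]-oo, - x]) Iho.
apply: hasI_unique h1 _; apply: eq_hasI h2 => y; rewrite !patchE !mem_setE !in_itv/=.
by rewrite andbT lerNr.
Qed.

Lemma ae_eq_halfline h g x : measurable_fun setT h -> measurable_fun setT g -> ae_eq mu setT h g ->
  \int[mu]_(y in `]-oo, x]) h y = \int[mu]_(y in `]-oo, x]) g y.
Proof.
move=> mh mg hg; rewrite /Rintegral; congr fine; apply: ae_eq_integral => //.
- by apply/measurable_EFinP; exact: measurable_funTS.
- by apply/measurable_EFinP; exact: measurable_funTS.
by apply: filterS hg => y /= /(_ Logic.I) ->.
Qed.

Lemma halfline_bound h x M : mu.-integrable setT (EFin \o h) ->
  (forall a, a <= x -> `|\int[mu]_(y in `[a, x]) h y| <= M) ->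
  `|\int[mu]_(y in `]-oo, x]) h y| <= M.
Proof.
move=> Ih HM; apply/ler_addgt0Pr => e e0.
have mD := measurable_itv `]-oo, x].
have hk := hasI_restrict mD Ih.
have [Ik Ek] := hk.
have [N [N0 HN]] := Rintegral_exhaust Ik e0.
pose a := Num.min (- N) x; pose b := Num.max N x.
have aN : a <= - N by rewrite ge_min lexx.
have ax : a <= x by rewrite ge_min lexx orbT.
have Nb : N <= b by rewrite le_max lexx.
have xb : x <= b by rewrite le_max lexx orbT.
have := HN a b aN Nb; rewrite Ek.
have -> : \int[mu]_(y in `[a, b]) (h \_ `]-oo, x]) y = \int[mu]_(y in `[a, x]) h y.
  rewrite -Rintegral_mkcondr; congr Rintegral.
  apply/seteqP; split => y /=; rewrite !in_itv/=.
    by move=> [/andP[-> _] ->].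
  by move=> /andP[-> yx]; rewrite yx (le_trans yx xb).
have := HM a ax; set I := Rintegral _ _ _; set J := Rintegral _ _ _ => h1 h2.
have -> : J = I + (J - I) by ring.
by apply: le_trans (ler_normD _ _) _; exact: lerD.
Qed.

Lemma cauchy_schwarz f g A B p : hasI (fun x => f x ^+ 2) A -> hasI (fun x => g x ^+ 2) B ->
  hasI (fun x => f x * g x) p -> p ^+ 2 <= A * B.
Proof.
move=> hA hB hp.
have A0 : 0 <= A by apply: hasI_ge0 hA => x; exact: sqr_ge0.
have B0 : 0 <= B by apply: hasI_ge0 hB => x; exact: sqr_ge0.
have key t : 0 <= A - 2 * t * p + t ^+ 2 * B.
  have := hasID (hasIB hA (hasIZ (2 * t) hp)) (hasIZ (t ^+ 2) hB).
  apply: hasI_ge0 => x /=.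
  have -> : f x ^+ 2 - 2 * t * (f x * g x) + t ^+ 2 * g x ^+ 2 = (f x - t * g x) ^+ 2 by ring.
  exact: sqr_ge0.
have [B00|Bn0] := eqVneq B 0.
  rewrite B00 mulr0; have [-> |pn0] := eqVneq p 0; first by rewrite expr0n.
  (* For B = 0 the quadratic form is affine in t; this t would give it the value -1. *)
  have := key ((A + 1) / (2 * p)); rewrite B00 mulr0 addr0.
  have -> : 2 * ((A + 1) / (2 * p)) * p = A + 1 by field.
  by rewrite opprD addrA subrr add0r oppr_ge0 ler10.
have Bp : 0 < B by rewrite lt0r Bn0.
have := key (p / B).
have -> : A - 2 * (p / B) * p + (p / B) ^+ 2 * B = (A * B - p ^+ 2) / B by field.
by rewrite pmulr_lge0 ?invr_gt0// subr_ge0.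
Qed.

End HalfLine.

Section Adjoint.
Variable R : realType.
Local Notation mu := (@lebesgue_measure R).
Implicit Types (f g h u V dV : R -> R) (a b x y r e M : R) (n : nat).

(* Otherwise comparing two integrals unfolds [powR] and [expR]. *)
#[local] Opaque Q th.

Lemma th2_ge0 x : 0 <= 2 + th x.
Proof. by have := th_bounds x; lra. Qed.

(** On the negative half-line Q^(n+1) is at most the derivative of (2 + th) Q^(n+1): with t = th in
    [-1, 0], the difference is at least Q^(n+1) (1 - 3 t) (1 + t). The factor [Q x ^+ n.+1] kept on
    the right cancels the inverse weight in [adj]. *)
Lemma QX_tail n a x : a <= x -> x <= 0 -> \int[mu]_(y in `[a, x]) Q y ^+ n.+1 <= 2 * Q x ^+ n.+1.
Proof.
move=> ax x0.
have [lB BE] := ACM (ACD (AC_cst 2) (@AC_th R)) (@AC_QX R n).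
apply: (@le_trans _ _ (\int[mu]_(y in `[a, x])
   ((2 + th y) * - (n.+1%:R * th y * Q y ^+ n.+1) + Q y ^+ n.+1 * (0 + 2 * (1 - th y ^+ 2))))).
  apply: le_Rintegral => //.
    by apply: continuous_locint; exact: continuous_QX.
  move=> y /=; rewrite in_itv/= => /andP[ay yx].
  have Q0 : 0 < Q y ^+ n.+1 by apply: exprn_gt0; exact: Q_gt0.
  have t0 := th_le0 (le_trans yx x0); have /andP[t1 _] := th_bounds y.
  have n1 : (1 : R) <= n.+1%:R by rewrite ler1n.
  rewrite -subr_ge0; set q := Q y ^+ n.+1; set t := th y; set m := n.+1%:R.
  have -> : (2 + t) * - (m * t * q) + q * (0 + 2 * (1 - t ^+ 2)) - q =
    q * (1 - 2 * t ^+ 2 + m * (- t) * (2 + t)) by ring.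
  apply: mulr_ge0; first exact: ltW.
  have h1 : 0 <= - t * (2 + t) by apply: mulr_ge0; rewrite /t; lra.
  have h2 : - t * (2 + t) <= m * (- t * (2 + t)) by rewrite ler_peMl.
  have h3 : m * - t * (2 + t) = m * (- t * (2 + t)) by ring.
  rewrite h3; have : 0 <= 1 - 2 * t ^+ 2 + - t * (2 + t) by rewrite /t; nra.
  lra.
rewrite -BE//.
have Qa : 0 < Q a ^+ n.+1 by apply: exprn_gt0; exact: Q_gt0.
have Qx : 0 < Q x ^+ n.+1 by apply: exprn_gt0; exact: Q_gt0.
have h1 : (2 + th x) * Q x ^+ n.+1 <= 2 * Q x ^+ n.+1.
  by rewrite ler_pM2r// gerDl th_le0.
have h2 : 0 <= (2 + th a) * Q a ^+ n.+1 := mulr_ge0 (th2_ge0 a) (ltW Qa).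
by apply: le_trans h1; rewrite gerBl.
Qed.

Lemma halfline_QX_bound n h x M : 0 <= M -> mu.-integrable setT (EFin \o h) ->
  (forall y, `|h y| <= M * Q y ^+ n.+1) -> x <= 0 ->
  `|\int[mu]_(y in `]-oo, x]) h y| <= 2 * M * Q x ^+ n.+1.
Proof.
move=> M0 Ih hM x0; apply: halfline_bound => // a ax.
have lh := integrable_locint Ih.
apply: le_trans (le_normr_Rintegral _ (lh a x)) _ => //.
have lq : locint (fun y => Q y ^+ n.+1) by apply: continuous_locint; exact: continuous_QX.
apply: (@le_trans _ _ (\int[mu]_(y in `[a, x]) (M * Q y ^+ n.+1))).
  apply: le_Rintegral => //; first exact: (locint_norm lh).
  exact: (locintZ M lq).
rewrite RintegralZl// -mulrA mulrCA.
by apply: ler_wpM2l => //; exact: QX_tail.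
Qed.

(* Off by one: [adj n g] is the solution [f] of [A_(n+1)^* f = g], and [adj' n g]
   is its derivative. *)
Definition adj n g x := - ((Q x ^+ n.+1)^-1 * \int[mu]_(y in `]-oo, x]) (Q y ^+ n.+1 * g y)).

Definition adj' n g x := n.+1%:R * th x * adj n g x - g x.

Lemma sqI_QX n : sqI (fun x => @Q R x ^+ n.+1).
Proof.
elim: n => [|n IH]; first exact: sqI_Q.
have H := @sqI_bounded R (fun x => Q x ^+ n.+1) (@Q R) 2 _ _ IH.
have -> : (fun x => Q x ^+ n.+2) = (fun x => Q x * Q x ^+ n.+1).
  by apply/funext => x; rewrite exprS.
apply: H; first by apply: continuous_measurable_fun; exact: continuous_Q.
by move=> x; rewrite ger0_norm ?Q_le2// ltW// Q_gt0.
Qed.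

(** Evenness holds pointwise for [u] but is not known so for its representative [g], so the
    integrals are moved to [u] before reflecting. The vanishing total integral then exchanges the
    two half-lines up to sign. *)
Lemma adj_odd n g u : measurable_fun setT g -> sqI u -> ae_eq mu setT u g ->
  (forall x, u (- x) = u x) -> hasI (fun x => Q x ^+ n.+1 * g x) 0 ->
  forall x, adj n g (- x) = - adj n g x.
Proof.
move=> mg su ug ue hg x; rewrite /adj QN.
suff -> : \int[mu]_(y in `]-oo, (- x)]) (Q y ^+ n.+1 * g y) =
    - \int[mu]_(y in `]-oo, x]) (Q y ^+ n.+1 * g y) by rewrite mulrN.
have [Ig Eg] := hg; have [mu_ _] := su.
have mQ : measurable_fun setT (fun x : R => Q x ^+ n.+1).
  by apply: continuous_measurable_fun; exact: continuous_QX.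
have Iu := sqIM (sqI_QX n) su.
have E y : \int[mu]_(t in `]-oo, y]) (Q t ^+ n.+1 * g t) =
           \int[mu]_(t in `]-oo, y]) (Q t ^+ n.+1 * u t).
  apply: ae_eq_halfline; [exact: measurable_funM | exact: measurable_funM |].
  by apply: filterS ug => t /= /(_ Logic.I) ->.
have E0 : \int[mu]_t (Q t ^+ n.+1 * u t) = 0.
  apply: hasI_unique hg; apply: hasI_ae (integrable_hasI Iu).
    exact: measurable_funM.
  by apply: filterS ug => t /= /(_ Logic.I) ->.
rewrite !E; have := Rintegral_halflines x Iu; rewrite E0 => /esym/eqP.
rewrite addr_eq0 => /eqP ->; rewrite opprK (Rintegral_halfline_opp _ Iu).
by apply: eq_Rintegral => t _; rewrite QN ue.
Qed.

Lemma AC_adj n g : mu.-integrable setT (EFin \o (fun x => Q x ^+ n.+1 * g x)) ->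
  AC (adj n g) (adj' n g).
Proof.
move=> Ig.
have AF : AC (fun x => \int[mu]_(y in `]-oo, x]) (Q y ^+ n.+1 * g y)) (fun x => Q x ^+ n.+1 * g x).
  split; first exact: integrable_locint.
  by move=> a b ab; rewrite Rintegral_halfline_cat.
apply: AC_eq (ACZ (-1) (ACM (@AC_QXV R n) AF)) => x; rewrite /adj' /adj ?mulN1r//.
by field; rewrite expf_neq0// gt_eqF// Q_gt0.
Qed.

(** For x <= 0 the tail estimate applies directly. For x > 0 the orthogonality replaces the integral
    by minus the one over [x, +oo[, which reflects to the first case; otherwise the inverse weight
    would blow up. *)
Lemma adj_bounded n g M : measurable_fun setT g -> (forall x, `|g x| <= M) ->
  hasI (fun x => Q x ^+ n.+1 * g x) 0 -> forall x, `|adj n g x| <= 2 * M.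
Proof.
move=> mg gM [Ig Eg].
have M0 : 0 <= M by apply: le_trans (gM 0).
have Q0 x : 0 < Q x ^+ n.+1 by apply: exprn_gt0; exact: Q_gt0.
have bnd (s : R -> R) x : (forall y, Q (s y) = Q y) -> x <= 0 ->
    mu.-integrable setT (EFin \o (fun y => Q (s y) ^+ n.+1 * g (s y))) ->
  `|\int[mu]_(y in `]-oo, x]) (Q (s y) ^+ n.+1 * g (s y))| <= 2 * M * Q x ^+ n.+1.
  move=> Qs x0 Is; apply: halfline_QX_bound => // y.
  by rewrite normrM Qs mulrC [`|Q y ^+ _|]gtr0_norm// ler_pM2r.
suff H x : `|\int[mu]_(y in `]-oo, x]) (Q y ^+ n.+1 * g y)| <= 2 * M * Q x ^+ n.+1.
  move=> x; rewrite /adj normrN normrM gtr0_norm ?invr_gt0//.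
  by rewrite mulrC ler_pdivrMr.
have [x0|x0] := leP x 0; first exact: (bnd id).
have := Rintegral_halflines x Ig; rewrite Eg => /esym/eqP.
rewrite addr_eq0 => /eqP ->; rewrite normrN (Rintegral_halfline_opp _ Ig).
rewrite -[Q x]QN; apply: (bnd -%R); [exact: QN | lra |].
exact: (hasI_opp (integrable_hasI Ig)).1.
Qed.

(** With m = n + 1, the potential in A_m A_m^* = - d^2 + W. For n = 2 it is 6 + 3 th^2, the
    potential of [L_-] plus 8. *)
Let W n x : R := (n.+1%:R * th x) ^+ 2 + n.+1%:R * (2 * (1 - th x ^+ 2)).

Lemma W_ge1 n x : 1 <= W n x.
Proof.
have n1 : (1 : R) <= n.+1%:R by rewrite ler1n.
have t1 := th_lt1 x; have t0 := sqr_ge0 (th x).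
rewrite /W exprMn; move: n1 t1 t0; set m := n.+1%:R; set t := th x ^+ 2 => n1 t1 t0.
have h1 : 0 <= t * (m ^+ 2 - 1) by apply: mulr_ge0 => //; nra.
have h2 : 0 <= (1 - t) * (m - 1) by apply: mulr_ge0; lra.
nra.
Qed.

Let measurable_th : measurable_fun setT (@th R).
Proof. by apply: continuous_measurable_fun; exact: continuous_th. Qed.

Let measurable_sech2 : measurable_fun setT (fun x : R => 1 - th x ^+ 2).
Proof.
by apply: measurable_funB => //; exact: (measurable_funX 2 measurable_th).
Qed.

Let measurable_W n : measurable_fun setT (W n).
Proof.
have : measurable_fun setT (fun x => (n.+1%:R * th x) ^+ 2 + n.+1%:R * (2 * (1 - th x ^+ 2))).
  apply: measurable_funD; last by do 2 (apply: measurable_funM => //).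
  by apply: (measurable_funX 2); exact: measurable_funM.
by [].
Qed.

Let norm_sech2 x : `|1 - th x ^+ 2| <= 1.
Proof. by rewrite ger0_norm; have := th_lt1 x; have := sqr_ge0 (th x); lra. Qed.

(** The derivative of m th V^2, m = n + 1, and the only difference between squares and energy
    densities: (V' + m th V)^2 is V'^2 + ((m th)^2 - 2 m (1 - th^2)) V^2 + D, and (V' - m th V)^2 is
    V'^2 + W V^2 - D. *)
Let D n V dV x : R := (n.+1%:R * th x) * (V x * dV x + V x * dV x) +
   (V x * V x) * (n.+1%:R * (2 * (1 - th x ^+ 2))).

Lemma AC_D n V dV : AC V dV -> AC (fun x => (n.+1%:R * th x) * (V x * V x)) (D n V dV).
Proof. by move=> AV; exact: ACM (ACZ n.+1%:R (@AC_th R)) (ACM AV AV). Qed.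

Lemma hasI_D n V dV : AC V dV -> sqI V -> sqI dV -> hasI (D n V dV) 0.
Proof.
move=> AV sV sdV; apply: AC_hasI0 (AC_D n AV) _ _.
  have h := integrable_bounded measurable_th (@norm_th R) (sqIM sV sV).
  by apply: eq_integrableT (hasIZ n.+1%:R (integrable_hasI h)).1 => x; rewrite mulrA.
have h1 := integrable_bounded measurable_th (@norm_th R) (sqIM sV sdV).
have h2 := integrable_bounded measurable_sech2 norm_sech2 (sqIM sV sV).
apply: eq_integrableT (hasID (hasIZ (2 * n.+1%:R) (integrable_hasI h1))
  (hasIZ (2 * n.+1%:R) (integrable_hasI h2))).1 => x.
by rewrite /D; ring.
Qed.

(** [hasI_D] would presuppose the conclusion. Instead the identity f'^2 + W f^2 = g^2 + D is
    integrated over [-N, N], where D yields boundary terms bounded uniformly in N, and W >= 1. *)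
Lemma sqI_adj n g M : measurable_fun setT g -> (forall x, `|g x| <= M) -> sqI g ->
  hasI (fun x => Q x ^+ n.+1 * g x) 0 -> sqI (adj n g) /\ sqI (adj' n g).
Proof.
move=> mg gM sg hg.
have [_ Ig] := sg.
have Af := AC_adj hg.1; have bf := adj_bounded mg gM hg.
have cf := AC_continuous Af.
have mf : measurable_fun setT (adj n g) by exact: continuous_measurable_fun.
have M0 : 0 <= M by apply: le_trans (gM 0).
set f := adj n g in Af bf cf mf *; set f' := adj' n g in Af *.
have [lD DE] := AC_D n Af.
have key x : f' x ^+ 2 + W n x * f x ^+ 2 = g x ^+ 2 + D n f f' x.
  by rewrite /D /W /f' /adj' -/f; ring.
have [lg _] := (integrable_locint Ig, 0%N).
have lk : locint (fun x => f' x ^+ 2 + W n x * f x ^+ 2).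
  by apply: eq_locint (locintD lg lD) => x; rewrite key.
have mf' : measurable_fun setT f'.
  by apply: measurable_funB => //; apply: measurable_funM => //; apply: measurable_funM.
have mk : measurable_fun setT (fun x => f' x ^+ 2 + W n x * f x ^+ 2).
  apply: measurable_funD; first exact: (measurable_funX 2 mf').
  by apply: measurable_funM; [exact: measurable_W | exact: (measurable_funX 2 mf)].
have k0 x : 0 <= f' x ^+ 2 + W n x * f x ^+ 2.
  by rewrite addr_ge0 ?sqr_ge0// mulr_ge0 ?sqr_ge0// (le_trans _ (W_ge1 n x)).
have HN (N : nat) : \int[mu]_(x in `[(- N%:R), N%:R]) (f' x ^+ 2 + W n x * f x ^+ 2) <=
    \int[mu]_x g x ^+ 2 + 2 * (n.+1%:R * (2 * M) ^+ 2).
  have NN : - N%:R <= N%:R :> R by have : (0 : R) <= N%:R by []; lra.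
  under eq_Rintegral do rewrite key.
  rewrite RintegralD//; apply: lerD.
    have mA := measurable_itv `[(- N%:R : R), N%:R].
    apply: hasI_le (hasI_restrict mA Ig) (integrable_hasI Ig) => x.
    by rewrite patchE; case: ifPn => _ //; exact: sqr_ge0.
  rewrite -DE//.
  have B x : `|n.+1%:R * th x * (f x * f x)| <= n.+1%:R * (2 * M) ^+ 2.
    rewrite normrM [`|n.+1%:R * _|]normrM [`|f x * _|]normrM normr_nat.
    rewrite -mulrA ler_wpM2l// -[leRHS]mul1r.
    apply: ler_pM; [by [] | by apply: mulr_ge0 | exact: norm_th |].
    by rewrite expr2; apply: ler_pM; [by [] | by [] | exact: bf | exact: bf].
  have := B N%:R; have := B (- N%:R); rewrite !ler_norml => /andP[? ?] /andP[? ?]; lra.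
have [Ik _] := integrable_bounded_segments k0 mk lk HN.
split; split => //.
  apply: integrable_le Ik; first exact: (measurable_funX 2 mf).
  move=> x; rewrite ger0_norm ?sqr_ge0//.
  by have := W_ge1 n x; have := sqr_ge0 (f x); have := sqr_ge0 (f' x); nra.
apply: integrable_le Ik; first exact: (measurable_funX 2 mf').
move=> x; rewrite ger0_norm ?sqr_ge0//.
by have := W_ge1 n x; have := sqr_ge0 (f x); have := sqr_ge0 (f' x); nra.
Qed.

(** Square integrability being established, [D] now integrates to exactly 0. *)
Lemma adj_energy n g M G : measurable_fun setT g -> (forall x, `|g x| <= M) ->
  hasI (fun x => g x ^+ 2) G -> hasI (fun x => Q x ^+ n.+1 * g x) 0 ->
  hasI (fun x => adj' n g x ^+ 2 + W n x * adj n g x ^+ 2) G.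
Proof.
move=> mg gM hG hg.
have sg : sqI g by split => //; exact: hG.1.
have [sf sf'] := sqI_adj mg gM sg hg.
have hD := hasI_D n (AC_adj hg.1) sf sf'.
rewrite -[G]addr0; apply: eq_hasI (hasID hG hD) => x.
by rewrite /D /W /adj'; ring.
Qed.

(* [<g, V> = <adj n g, A V>] with [A = A_(n+1)], and [K = |A V|^2]; expand
   [|A V - l * adj n g|^2 >= 0]. *)
Lemma factor_lower_bound n g M V dV K p q l :
  measurable_fun setT g -> (forall x, `|g x| <= M) -> sqI g ->
  hasI (fun x => Q x ^+ n.+1 * g x) 0 ->
  AC V dV -> sqI V -> sqI dV ->
  hasI (fun x => dV x ^+ 2 + ((n.+1%:R * th x) ^+ 2 - n.+1%:R * (2 * (1 - th x ^+ 2))) * V x ^+ 2) K ->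
  hasI (fun x => g x * V x) p -> hasI (fun x => adj n g x ^+ 2) q ->
  2 * l * p - l ^+ 2 * q <= K.
Proof.
move=> mg gM sg hg AV sV sdV hK hp hq.
have [sf sf'] := sqI_adj mg gM sg hg.
have hD := hasI_D n AV sV sdV.
(* The derivative of [adj n g * V] integrates to 0; substituting [adj'] turns this into the duality
   <adj n g, A V> = <g, V>. *)
have hP : hasI (fun x => adj n g x * dV x + V x * adj' n g x) 0.
  apply: AC_hasI0 (ACM (AC_adj hg.1) AV) _ _; first exact: sqIM.
  exact: (hasID (integrable_hasI (sqIM sf sdV)) (integrable_hasI (sqIM sV sf'))).1.
have H := hasID (hasIB (hasID hK hD) (hasID (hasIZ (2 * l) hP) (hasIZ (2 * l) hp))) (hasIZ (l ^+ 2) hq).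
suff : 0 <= K + 0 - (2 * l * 0 + 2 * l * p) + l ^+ 2 * q by lra.
apply: hasI_ge0 H => x.
rewrite [leRHS](_ : _ = (dV x + n.+1%:R * th x * V x - l * adj n g x) ^+ 2).
  exact: sqr_ge0.
by rewrite /D /adj'; ring.
Qed.

End Adjoint.

(** * Coercivity of the linearized operators *)

Section Coercivity.
Variable R : realType.
Local Notation mu := (@lebesgue_measure R).
Implicit Types (f g h u v U dU V dV : R -> R) (a b x y r e M A B K p q : R).

Lemma measurable_QX n : measurable_fun setT (fun x : R => Q x ^+ n).
Proof. by apply: continuous_measurable_fun; exact: continuous_QX. Qed.

Lemma adj_sq_le n g M G : measurable_fun setT g -> (forall x, `|g x| <= M) ->
  hasI (fun x => g x ^+ 2) G -> hasI (fun x => Q x ^+ n.+1 * g x) 0 ->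
  \int[mu]_x adj n g x ^+ 2 <= G.
Proof.
move=> mg gM hG hg.
have sg : sqI g by split => //; exact: hG.1.
have [[_ If] _] := sqI_adj mg gM sg hg.
apply: hasI_le (integrable_hasI If) (adj_energy mg gM hG hg) => x.
by have := W_ge1 n x; have := sqr_ge0 (adj n g x); have := sqr_ge0 (adj' n g x); nra.
Qed.

Lemma Lminus_perp_Q f df M A K : AC f df -> sqI f -> sqI df -> (forall x, `|f x| <= M) ->
  hasI (fun x => Q x * f x) 0 -> hasI (fun x => f x ^+ 2) A ->
  hasI (fun x => df x ^+ 2 + (3 * th x ^+ 2 - 2) * f x ^+ 2) K -> A <= K.
Proof.
move=> Af sf sdf fM h0 hA hK.
have [mf _] := sf.
have h0' : hasI (fun x => Q x ^+ 1 * f x) 0 by [].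
have [[_ Ik] _] := sqI_adj mf fM sf h0'.
have hle := adj_sq_le mf fM hA h0'.
have hK' : hasI (fun x => df x ^+ 2 + ((1%:R * th x) ^+ 2 - 1%:R * (2 * (1 - th x ^+ 2))) * f x ^+ 2) K.
  by apply: eq_hasI hK => x; ring.
have hp : hasI (fun x => f x * f x) A by apply: eq_hasI hA => x; rewrite expr2.
(* With g = V = f and l = 1 this reads 2 A - q <= K, where q <= A. *)
have := factor_lower_bound 1 mf fM sf h0' Af sf sdf hK' hp (integrable_hasI Ik).
lra.
Qed.

Lemma Lplus_coercive u U dU M A K : sqI u -> ae_eq mu setT u U -> (forall x, u (- x) = u x) ->
  AC U dU -> sqI U -> sqI dU -> (forall x, `|U x| <= M) ->
  hasI (fun x => Q x ^+ 3 * U x) 0 -> hasI (fun x => U x ^+ 2) A ->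
  hasI (fun x => dU x ^+ 2 + U x ^+ 2 - 15 * (1 - th x ^+ 2) * U x ^+ 2) K ->
  A <= K.
Proof.
move=> su uU ue AU sU sdU UM h0 hA hK; have [mU _] := sU.
have fodd := adj_odd mU su uU ue h0.
have [sf sf'] := sqI_adj mU UM sU h0.
have Af := AC_adj h0.1; have fM := adj_bounded mU UM h0.
have hE := adj_energy mU UM hA h0.
have [mf If] := sf; set q := \int[mu]_x adj 2 U x ^+ 2.
have hq : hasI (fun x => adj 2 U x ^+ 2) q by [].
have hQf : hasI (fun x => Q x * adj 2 U x) 0.
  have I := sqIM (sqI_Q R) sf.
  by split=> //; apply: hasI_odd (integrable_hasI I) => x; rewrite QN fodd mulrN.
(* Here [W 2] is the potential of [L_-] plus 8, so the [L_-] bound for the odd function [adj 2 U]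
   gives q <= A - 8 q, that is 9 q <= A. *)
have hK0 : hasI (fun x => adj' 2 U x ^+ 2 + (3 * th x ^+ 2 - 2) * adj 2 U x ^+ 2) (A - 8 * q).
  by apply: eq_hasI (hasIB hE (hasIZ 8 hq)) => x; ring.
have q_le := Lminus_perp_Q Af sf sf' fM hQf hq hK0.
have hK' : hasI (fun x => dU x ^+ 2 + ((3%:R * th x) ^+ 2 - 3%:R * (2 * (1 - th x ^+ 2))) * U x ^+ 2) (K + 8 * A).
  by apply: eq_hasI (hasID hK (hasIZ 8 hA)) => x; ring.
have hp : hasI (fun x => U x * U x) A by apply: eq_hasI hA => x; rewrite expr2.
(* From 9 q <= A, the choice l = 9 gives 18 A - 81 q >= 9 A, and 9 A <= K + 8 A is the claim. *)
have := factor_lower_bound 9 mU UM sU h0 AU sU sdU hK' hp hq.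
lra.
Qed.

Lemma int_Q4_gt0 : 0 < \int[mu]_x (Q x : R) ^+ 4.
Proof.
have [mQ IQ] := sqI_QX R 1.
have I4 : hasI (fun x : R => Q x ^+ 4) (\int[mu]_x Q x ^+ 4).
  by apply: integrable_hasI; apply: eq_integrableT IQ => x; rewrite -exprM.
have mA := measurable_itv `[(-1 : R), 1].
apply: (@lt_le_trans _ _ (\int[mu]_(x in `[(-1), 1]) (Q x : R) ^+ 4)); last first.
  apply: hasI_le (hasI_restrict mA I4.1) I4 => x.
  by rewrite patchE; case: ifPn => _ //; rewrite exprn_ge0// ltW// Q_gt0.
have [lT TE] := ACZ (3 / 2) (@AC_th R).
have := TE (-1) 1; rewrite thN => /(_ _).
have -> : \int[mu]_(x in `[(-1), 1]) (3 / 2 * (2 * (1 - th x ^+ 2))) = \int[mu]_(x in `[(-1), 1]) Q x ^+ 4.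
  by apply: eq_Rintegral => x _; rewrite Q4; field.
move=> <-; last lra.
by have := @th_gt0 R 1 ltr01; lra.
Qed.

(** The constant is gamma = 1 / (1 + kappa) with kappa = |Q|^2 |Q^3|^2 / (Q, Q^3)^2: it measures how
    far Q^3 is from the direction of the ground state Q. *)
Lemma Lminus_coercive : exists gamma : R, 0 < gamma <= 1 /\ forall V dV M A K,
  AC V dV -> sqI V -> sqI dV -> (forall x, `|V x| <= M) ->
  hasI (fun x => Q x ^+ 3 * V x) 0 -> hasI (fun x => V x ^+ 2) A ->
  hasI (fun x => dV x ^+ 2 + V x ^+ 2 - 3 * (1 - th x ^+ 2) * V x ^+ 2) K ->
  gamma * A <= K.
Proof.
have [mQ1 IQ1] := sqI_Q R; have [mQ2 IQ2] := sqI_QX R 1; have [mQ3 IQ3] := sqI_QX R 2.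
have q40 := int_Q4_gt0.
set q4 := \int[mu]_x _ in q40.
pose q2 := \int[mu]_x (Q x : R) ^+ 2; pose q6 := \int[mu]_x ((Q x : R) ^+ 3) ^+ 2.
have hq2 : hasI (fun x : R => Q x ^+ 2) q2 by [].
have hq6 : hasI (fun x : R => (Q x ^+ 3) ^+ 2) q6 by [].
have hq4 : hasI (fun x : R => Q x ^+ 4) q4.
  by apply: integrable_hasI; apply: eq_integrableT IQ2 => x; rewrite -exprM.
have q20 : 0 <= q2 by apply: hasI_ge0 hq2 => x; exact: sqr_ge0.
have q60 : 0 <= q6 by apply: hasI_ge0 hq6 => x; exact: sqr_ge0.
pose kappa := q2 * q6 / q4 ^+ 2.
have k0 : 0 <= kappa by rewrite /kappa divr_ge0 ?sqr_ge0// mulr_ge0.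
have k1 : 0 < 1 + kappa by lra.
exists ((1 + kappa)^-1); split.
  by rewrite invr_gt0 k1 /= -[leRHS]invr1 lef_pV2 ?posrE//; lra.
move=> V dV M A K AV sV sdV VM h0 hA hK; have [mV IV] := sV.
have IQV := sqIM (sqI_Q R) sV.
set b := \int[mu]_x (Q x * V x).
have hb : hasI (fun x => Q x * V x) b by [].
pose a := b / q4.
(* [g] is orthogonal to [Q] although [V] is only orthogonal to [Q ^+ 3], and still [<g, V> = |V|^2]. *)
pose g x := V x - a * Q x ^+ 3.
have mg : measurable_fun setT g.
  by apply: measurable_funB => //; apply: measurable_funM.
have gM x : `|g x| <= M + `|a| * 2 ^+ 3.
  apply: le_trans (ler_normB _ _) _; apply: lerD => //.
  rewrite normrM ler_wpM2l// normrX lerXn2r ?nnegrE//.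
  by rewrite gtr0_norm ?Q_gt0// Q_le2.
have hg2 : hasI (fun x => g x ^+ 2) (A - 2 * a * 0 + a ^+ 2 * q6).
  apply: eq_hasI (hasID (hasIB hA (hasIZ (2 * a) h0)) (hasIZ (a ^+ 2) hq6)) => x.
  by rewrite /g; ring.
have sg : sqI g by split => //; exact: hg2.1.
have hgQ : hasI (fun x => Q x ^+ 1 * g x) 0.
  have -> : 0 = b - a * q4 by rewrite /a divfK ?subrr// gt_eqF.
  by apply: eq_hasI (hasIB hb (hasIZ a hq4)) => x; rewrite /g; ring.
have hgV : hasI (fun x => g x * V x) (A - a * 0).
  by apply: eq_hasI (hasIB hA (hasIZ a h0)) => x; rewrite /g; ring.
have [[_ Ik] _] := sqI_adj mg gM sg hgQ.
have hle := adj_sq_le mg gM hg2 hgQ.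
have hK' : hasI (fun x => dV x ^+ 2 + ((1%:R * th x) ^+ 2 - 1%:R * (2 * (1 - th x ^+ 2))) * V x ^+ 2) K.
  by apply: eq_hasI hK => x; ring.
(* Since q <= |g|^2 <= (1 + kappa) A, the bound 2 l A - l^2 (1 + kappa) A is largest at this l, with
   value l A. *)
have := factor_lower_bound (1 + kappa)^-1 mg gM sg hgQ AV sV sdV hK' hgV (integrable_hasI Ik).
move: hle; set q := Rintegral _ _ _ => hle hlow.
have ba : a ^+ 2 * q6 <= kappa * A.
  have cs := cauchy_schwarz hq2 hA hb.
  have -> : a ^+ 2 * q6 = b ^+ 2 * (q6 / q4 ^+ 2) by rewrite /a; field; rewrite gt_eqF.
  have -> : kappa * A = q2 * A * (q6 / q4 ^+ 2) by rewrite /kappa; field; rewrite gt_eqF.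
  by apply: ler_wpM2r cs; rewrite divr_ge0 ?sqr_ge0.
set l := (1 + kappa)^-1 in hlow *.
have lk : l * (1 + kappa) = 1 by rewrite /l mulVf// gt_eqF.
have qle : q <= (1 + kappa) * A by lra.
have l2 : l ^+ 2 * q <= l ^+ 2 * ((1 + kappa) * A) by apply: ler_wpM2l => //; exact: sqr_ge0.
have l3 : l ^+ 2 * ((1 + kappa) * A) = l * A.
  by rewrite expr2 -mulrA [l * ((1 + kappa) * A)]mulrA lk mul1r.
rewrite mulr0 subr0 in hlow.
have -> : l * A = 2 * l * A - l * A by ring.
by apply: le_trans hlow; rewrite lerB// -l3.
Qed.

(** The derivative of U^2 is integrated from a point on the left where U^2 is small, then
    Cauchy-Schwarz applies. Squaring once more avoids square roots. *)
Lemma sup_bound U dU A B x : AC U dU -> sqI U -> sqI dU ->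
  hasI (fun x => U x ^+ 2) A -> hasI (fun x => dU x ^+ 2) B ->
  (U x ^+ 2) ^+ 2 <= 4 * (A * B).
Proof.
move=> AU sU sdU hA hB.
have hS := hasI_norm (integrable_hasI (sqIM sU sdU)).
set S := \int[mu]_x `|U x * dU x| in hS.
have S0 : 0 <= S by apply: hasI_ge0 hS.
have SAB : S ^+ 2 <= A * B.
  have hA' : hasI (fun x => `|U x| ^+ 2) A.
    by apply: eq_hasI hA => y; rewrite real_normK ?num_real.
  have hB' : hasI (fun x => `|dU x| ^+ 2) B.
    by apply: eq_hasI hB => y; rewrite real_normK ?num_real.
  by apply: cauchy_schwarz hA' hB' _; apply: eq_hasI hS => y; rewrite normrM.
have US : U x ^+ 2 <= 2 * S.
  apply/ler_addgt0Pr => e e0.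
  have [N [N0 HN]] := integrable_small hA.1 e0.
  have [y /andP[_ yx] Uy] := HN (x - N); rewrite subrK in yx.
  have [lUU EUU] := ACM AU AU; have := EUU y x yx.
  have : \int[mu]_(t in `[y, x]) (U t * dU t + U t * dU t) <= 2 * S.
    have mA := measurable_itv `[y, x].
    apply: (@le_trans _ _ (\int[mu]_(t in `[y, x]) (2 * `|U t * dU t|))).
      apply: le_Rintegral => //.
        exact: (locintZ 2 (integrable_locint hS.1)).
      by move=> t _; have := ler_norm (U t * dU t); lra.
    have h2 := hasIZ 2 hS.
    apply: hasI_le (hasI_restrict mA h2.1) h2 => t.
    by rewrite patchE; case: ifPn => _ //; rewrite mulr_ge0.
  set I := Rintegral _ _ _ => I2 IE.
  have := ler_norm (U y ^+ 2); move: IE Uy; rewrite -!expr2; lra.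
have U0 := sqr_ge0 (U x).
apply: (@le_trans _ _ ((2 * S) ^+ 2)); first by rewrite lerXn2r ?nnegrE//; lra.
by rewrite exprMn; lra.
Qed.

(** With r^2 = rho, |u| <= r and k <= 2, the left side is at most 160 r^3 + 60 r^4 + 12 r^5 + r^6.
    As r^4 and r^5 are at most r^3 + r^6, this gives 232 r^3 + 73 r^6; then r^3 <= eta r^2 when r <=
    eta, and r^3 <= r^6 / eta^3 otherwise. *)
Lemma remainder_bound (eta k u v rho : R) : 0 < eta -> 0 <= k <= 2 ->
  rho = u ^+ 2 + v ^+ 2 ->
  12 * k ^+ 3 * u * rho + 3 * k ^+ 2 * rho ^+ 2 + (2 * k * u + rho) ^+ 3 <=
  232 * eta * rho + (232 / eta ^+ 3 + 73) * rho ^+ 3.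
Proof.
move=> e0 /andP[k0 k2] rhoE.
have rho0 : 0 <= rho by rewrite rhoE addr_ge0 ?sqr_ge0.
pose r : R := Num.sqrt rho.
have r0 : 0 <= r by exact: sqrtr_ge0.
have r2 : rho = r ^+ 2 by rewrite sqr_sqrtr.
have ur : `|u| <= r.
  rewrite -(@ler_pXn2r _ 2)// ?nnegrE// -r2 real_normK ?num_real//.
  by rewrite rhoE lerDl sqr_ge0.
have u_le : u <= r := le_trans (ler_norm u) ur.
have uk : k ^+ 3 * u <= 8 * r.
  have k8 : k ^+ 3 <= 8.
    have -> : 8 = 2 ^+ 3 :> R by ring.
    by rewrite lerXn2r ?nnegrE.
  apply: (@le_trans _ _ (k ^+ 3 * r)); first by rewrite ler_wpM2l ?exprn_ge0.
  by rewrite ler_wpM2r.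
have t1 : 12 * k ^+ 3 * u * rho <= 96 * r ^+ 3.
  have -> : 12 * k ^+ 3 * u * rho = 12 * (k ^+ 3 * u) * rho by ring.
  have -> : 96 * r ^+ 3 = 12 * (8 * r) * rho by rewrite r2; ring.
  by rewrite ler_wpM2r// ler_wpM2l.
have t2 : 3 * k ^+ 2 * rho ^+ 2 <= 12 * r ^+ 4.
  have -> : 12 * r ^+ 4 = 12 * rho ^+ 2 by rewrite r2; ring.
  by rewrite ler_wpM2r ?sqr_ge0//; nra.
have t3 : (2 * k * u + rho) ^+ 3 <= (4 * r + r ^+ 2) ^+ 3.
  have h : 2 * k * u + rho <= 4 * r + r ^+ 2 by rewrite r2; nra.
  have h0 : 0 <= 4 * r + r ^+ 2 by rewrite -r2; lra.
  have [n0|n0] := leP 0 (2 * k * u + rho); first by rewrite lerXn2r ?nnegrE.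
  apply: (@le_trans _ _ 0); last by rewrite exprn_ge0.
  by rewrite exprS nmulr_rle0// sqr_ge0.
have p3 : 0 <= r ^+ 3 by rewrite exprn_ge0.
have p2 : 0 <= r ^+ 2 by rewrite exprn_ge0.
have p6 : 0 <= r ^+ 6 by rewrite exprn_ge0.
have p4 : r ^+ 4 <= r ^+ 3 + r ^+ 6.
  have [r1|r1] := leP r 1.
    have h : r ^+ 4 <= r ^+ 3 by apply: ler_wiXn2l => //; exact: ltW.
    lra.
    have h : r ^+ 4 <= r ^+ 6 by apply: ler_weXn2l => //; exact: ltW.
    lra.
have p5 : r ^+ 5 <= r ^+ 3 + r ^+ 6.
  have [r1|r1] := leP r 1.
    have h : r ^+ 5 <= r ^+ 3 by apply: ler_wiXn2l => //; exact: ltW.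
    lra.
    have h : r ^+ 5 <= r ^+ 6 by apply: ler_weXn2l => //; exact: ltW.
    lra.
have p3' : r ^+ 3 <= eta * r ^+ 2 + r ^+ 6 / eta ^+ 3.
  have q0 : 0 <= r ^+ 6 / eta ^+ 3 by rewrite divr_ge0// exprn_ge0// ltW.
  have [re|re] := leP r eta.
    have : r ^+ 3 <= eta * r ^+ 2 by rewrite exprS ler_wpM2r.
    lra.
  have : r ^+ 3 <= r ^+ 6 / eta ^+ 3.
    rewrite ler_pdivlMr ?exprn_gt0//.
    have -> : r ^+ 6 = r ^+ 3 * r ^+ 3 by ring.
    have e0' := ltW e0; have re' := ltW re.
    by apply: ler_wpM2l => //; rewrite lerXn2r ?nnegrE.
  have : 0 <= eta * r ^+ 2 by rewrite mulr_ge0// ltW.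
  lra.
have e3 : (4 * r + r ^+ 2) ^+ 3 = 64 * r ^+ 3 + 48 * r ^+ 4 + 12 * r ^+ 5 + r ^+ 6 by ring.
have -> : 232 * eta * rho + (232 / eta ^+ 3 + 73) * rho ^+ 3 =
  232 * (eta * r ^+ 2 + r ^+ 6 / eta ^+ 3) + 73 * r ^+ 6.
  by rewrite r2; field; rewrite gt_eqF.
lra.
Qed.

End Coercivity.

(** * Expansion of the energy *)

Section Energy.
Variable R : realType.
Local Notation mu := (@lebesgue_measure R).
Implicit Types (f g h u v U dU V dV : R -> R) (a b x y r e M A B K p q : R).

Lemma sqI_th f : sqI f -> sqI (fun x => th x * f x).
Proof.
apply: sqI_bounded; last exact: norm_th.
by apply: continuous_measurable_fun; exact: continuous_th.
Qed.

Lemma sqI_sech2 f : sqI f -> sqI (fun x => (1 - th x ^+ 2) * f x).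
Proof.
have mth : measurable_fun setT (@th R).
  by apply: continuous_measurable_fun; exact: continuous_th.
apply: (@sqI_bounded _ _ _ 1).
  by apply: measurable_funB => //; exact: (measurable_funX 2 mth).
by move=> x; rewrite ger0_norm; have := th_lt1 x; have := sqr_ge0 (th x); lra.
Qed.

(** As Q' = - th Q, the integrand is -2 times the energy density of [Q]. It is also half the
    derivative of th Q^2. *)
Lemma pohozaev_Q : hasI (fun x : R => Q x ^+ 6 / 3 - th x ^+ 2 * Q x ^+ 2) 0.
Proof.
have AQ : AC (fun x : R => th x * (Q x * Q x))
    (fun x => th x * (Q x * - (th x * Q x) + Q x * - (th x * Q x)) +
      (Q x * Q x) * (2 * (1 - th x ^+ 2))).
  have A1 : AC (@Q R) (fun x => - (th x * Q x)).
    by apply: AC_eq (@AC_QX R 0) => x; rewrite expr1 ?mul1r.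
  exact: ACM (@AC_th R) (ACM A1 A1).
have sQ := sqI_Q R; have sT := sqI_th sQ; have sS := sqI_sech2 sQ.
have I1 := sqIM sT sQ; have I2 := sqIM sT sT; have I3 := sqIM sS sQ.
have h0 : hasI (fun x : R => th x * (Q x * - (th x * Q x) + Q x * - (th x * Q x)) +
      (Q x * Q x) * (2 * (1 - th x ^+ 2))) 0.
  apply: AC_hasI0 AQ _ _; first by apply: eq_integrableT I1 => x; ring.
  apply: eq_integrableT (hasIB (hasIZ 2 (integrable_hasI I3))
    (hasIZ 2 (integrable_hasI I2))).1 => x; ring.
rewrite -[0](mulr0 2^-1); apply: eq_hasI (hasIZ 2^-1 h0) => x.
have -> : Q x ^+ 6 = Q x ^+ 2 * Q x ^+ 4 by ring.
by rewrite Q4; field.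
Qed.

(** The weak form of the soliton equation tested against [U]: the integrand is the derivative of Q'
    U = - th Q U. *)
Lemma euler_lagrange_Q U dU : AC U dU -> sqI U -> sqI dU ->
  hasI (fun x => - (th x * Q x) * dU x + Q x * U x - Q x ^+ 5 * U x) 0.
Proof.
move=> AU sU sdU.
have A1 : AC (@Q R) (fun x => - (th x * Q x)).
  by apply: AC_eq (@AC_QX R 0) => x; rewrite expr1 ?mul1r.
have sQ := sqI_Q R; have sT := sqI_th sQ; have sS := sqI_sech2 sQ.
have sTT := sqI_th sT.
have h0 : hasI (fun x => (th x * Q x) * dU x + U x * (th x * - (th x * Q x) + Q x * (2 * (1 - th x ^+ 2)))) 0.
  apply: AC_hasI0 (ACM (ACM (@AC_th R) A1) AU) _ _; first exact: sqIM.
  apply: eq_integrableT (hasID (integrable_hasI (sqIM sT sdU))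
    (hasIB (hasIZ 2 (integrable_hasI (sqIM sU sS))) (integrable_hasI (sqIM sU sTT)))).1 => x.
  ring.
rewrite -[0](mulr0 (-1)); apply: eq_hasI (hasIZ (-1) h0) => x.
have -> : Q x ^+ 5 = Q x * Q x ^+ 4 by ring.
by rewrite Q4; ring.
Qed.

(** Upgrades L^2 coercivity to H^1 by a convex combination of the two bounds. The 14 is 15 - 1, from
    the potential of [L_+]; with weight gamma / 16 the coefficient of A is gamma (2 - gamma) / 16,
    at least gamma / 16. *)
Lemma interpolate_form (gamma A B K : R) : 0 < gamma <= 1 -> 0 <= A -> 0 <= B ->
  gamma * A <= K -> B - 14 * A <= K -> gamma / 16 * (A + B) <= K.
Proof.
move=> /andP[g0 g1] A0 B0 h1 h2.
have -> : K = gamma / 16 * K + (1 - gamma / 16) * K by ring.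
apply: (@le_trans _ _ (gamma / 16 * (B - 14 * A) + (1 - gamma / 16) * (gamma * A))); last first.
  by apply: lerD; apply: ler_wpM2l => //; lra.
have gA : 0 <= gamma * A * (1 - gamma) by apply: mulr_ge0; [exact: mulr_ge0 (ltW g0) A0 | lra].
nra.
Qed.

Lemma energy_lower_bound : exists delta c : R, 0 < delta /\ 0 < c /\
  forall u U dU V dV A1 A2 B1 B2 m E1 E2,
  sqI u -> ae_eq mu setT u U -> (forall x, u (- x) = u x) ->
  AC U dU -> sqI U -> sqI dU -> AC V dV -> sqI V -> sqI dV ->
  hasI (fun x => Q x ^+ 3 * U x) 0 -> hasI (fun x => Q x ^+ 3 * V x) 0 ->
  hasI (fun x => U x ^+ 2) A1 -> hasI (fun x => V x ^+ 2) A2 ->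
  hasI (fun x => dU x ^+ 2) B1 -> hasI (fun x => dV x ^+ 2) B2 ->
  A1 + A2 <= delta ^+ 2 ->
  hasI (fun x => (Q x + U x) ^+ 2 + V x ^+ 2) m -> hasI (fun x : R => Q x ^+ 2) m ->
  hasI (fun x => (dQ x + dU x) ^+ 2 + dV x ^+ 2) E1 ->
  hasI (fun x => ((Q x + U x) ^+ 2 + V x ^+ 2) ^+ 3) E2 ->
  c * ((B1 + B2) + (A1 + A2)) <= 2^-1 * E1 - 6^-1 * E2.
Proof.
have [gamma [/andP[g0 g1] HL]] := Lminus_coercive R.
pose c0 := gamma / 16.
have c0E : c0 = gamma / 16 by [].
have c00 : 0 < c0 by clear HL; rewrite /c0; lra.
clearbody c0; pose eta := c0 / 232.
have eE : 232 * eta = c0 by rewrite /eta; field.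
have eta0 : 0 < eta by apply: divr_gt0; [exact: c00 | rewrite ltr0n].
clearbody eta; pose Ce := 232 / eta ^+ 3 + 73.
have CeE : Ce = 232 / eta ^+ 3 + 73 by [].
have e3 : 0 < eta ^+ 3 by exact: exprn_gt0.
have Ce0 : 0 < Ce.
  by apply: addr_gt0; [apply: divr_gt0 e3; rewrite ltr0n | rewrite ltr0n].
clearbody Ce.
(* The sextic remainder is at most 8 Ce A^2 B, and A <= delta^2 with delta <= 1 gives A^2 <=
   delta. *)
pose delta := Num.min 1 (c0 / (8 * Ce)).
have d0 : 0 < delta by rewrite lt_min ltr01 divr_gt0// mulr_gt0.
have d1 : delta <= 1 by rewrite ge_min lexx.
have dC : 8 * Ce * delta <= c0.
  by rewrite mulrC -ler_pdivlMr ?mulr_gt0// ge_min lexx orbT.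
clearbody delta.
(* c0 / 3 = c0 / 2 - c0 / 6: half the coercivity constant minus one sixth of a remainder bounded by
   c0 (A + B). *)
exists delta, (c0 / 3); split => //; split; first by rewrite divr_gt0.
move=> u U dU V dV A1 A2 B1 B2 m E1 E2 su uU ue AU sU sdU AV sV sdV h1 h2 hA1 hA2 hB1 hB2 hd hm hm' hE1 hE2.
have A10 : 0 <= A1 by apply: hasI_ge0 hA1 => x; exact: sqr_ge0.
have A20 : 0 <= A2 by apply: hasI_ge0 hA2 => x; exact: sqr_ge0.
have B10 : 0 <= B1 by apply: hasI_ge0 hB1 => x; exact: sqr_ge0.
have B20 : 0 <= B2 by apply: hasI_ge0 hB2 => x; exact: sqr_ge0.
have supU x := sup_bound x AU sU sdU hA1 hB1.
have supV x := sup_bound x AV sV sdV hA2 hB2.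
(* From t <= 1 + t^4. Only the existence of a bound matters to the coercivity lemmas; its value does
   not enter their conclusions. *)
have bound f A B : (forall x, (f x ^+ 2) ^+ 2 <= 4 * (A * B)) -> forall x, `|f x| <= 1 + 4 * (A * B).
  move=> H x; have := H x; rewrite -[f x ^+ 2]real_normK ?num_real//.
  have := normr_ge0 (f x); set t := `|f x| => t0 Ht.
  have [t1|t1] := leP t 1.
    have : 0 <= (t ^+ 2) ^+ 2 by exact: sqr_ge0.
    lra.
  have : t <= (t ^+ 2) ^+ 2 by rewrite -exprM -[leLHS]expr1 ler_weXn2l// ltW.
  lra.
have UM := bound _ _ _ supU; have VM := bound _ _ _ supV.
have hKp : hasI (fun x => dU x ^+ 2 + U x ^+ 2 - 15 * (1 - th x ^+ 2) * U x ^+ 2)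
    (B1 + A1 - 15 * \int[mu]_x ((1 - th x ^+ 2) * U x * U x)).
  have hs := integrable_hasI (sqIM (sqI_sech2 sU) sU).
  by apply: eq_hasI (hasIB (hasID hB1 hA1) (hasIZ 15 hs)) => x; ring.
have hKm : hasI (fun x => dV x ^+ 2 + V x ^+ 2 - 3 * (1 - th x ^+ 2) * V x ^+ 2)
    (B2 + A2 - 3 * \int[mu]_x ((1 - th x ^+ 2) * V x * V x)).
  have hs := integrable_hasI (sqIM (sqI_sech2 sV) sV).
  by apply: eq_hasI (hasIB (hasID hB2 hA2) (hasIZ 3 hs)) => x; ring.
have sech_le f A : sqI f -> hasI (fun x => f x ^+ 2) A ->
    \int[mu]_x ((1 - th x ^+ 2) * f x * f x) <= A.
  move=> sf hA; have hs := integrable_hasI (sqIM (sqI_sech2 sf) sf).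
  apply: hasI_le hs hA => x; rewrite -mulrA -expr2.
  by have := sqr_ge0 (f x); have := sqr_ge0 (th x); nra.
have s1 := sech_le _ _ sU hA1; have s2 := sech_le _ _ sV hA2.
have Kp := Lplus_coercive su uU ue AU sU sdU UM h1 hA1 hKp.
have Km := HL _ _ _ _ _ AV sV sdV VM h2 hA2 hKm.
move: hKp hKm s1 s2 Kp Km; set I1 := Rintegral _ _ _; set I2 := Rintegral _ _ _.
set Kp := B1 + A1 - _; set Km := B2 + A2 - _ => hKp hKm s1 s2 KpA KmA.
have KpH : c0 * (A1 + B1) <= Kp.
  rewrite c0E; apply: interpolate_form => //; first by rewrite g0.
    by apply: le_trans KpA; rewrite ler_piMl.
  by rewrite /Kp -addrA lerD2l -[leRHS]opprB lerN2 lerBlDr; lra.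
have KmH : c0 * (A2 + B2) <= Km.
  rewrite c0E; apply: interpolate_form => //; first by rewrite g0.
  by rewrite /Km -addrA lerD2l -[leRHS]opprB lerN2 lerBlDr; lra.
pose rho x := U x ^+ 2 + V x ^+ 2.
have rho0 x : 0 <= rho x by rewrite addr_ge0 ?sqr_ge0.
have hrho : hasI rho (A1 + A2) := hasID hA1 hA2.
pose A := A1 + A2; pose B := B1 + B2.
have A0 : 0 <= A by exact: addr_ge0.
have B0 : 0 <= B by exact: addr_ge0.
(* The factor 4 of the sup bound is doubled by (a + b)^2 <= 2 (a^2 + b^2). *)
have rho2 x : rho x ^+ 2 <= 8 * (A * B).
  have : rho x ^+ 2 <= 2 * ((U x ^+ 2) ^+ 2 + (V x ^+ 2) ^+ 2).
    by rewrite /rho; have := sqr_ge0 (U x ^+ 2 - V x ^+ 2); nra.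
  have : A1 * B1 + A2 * B2 <= A * B.
    have -> : A * B = A1 * B1 + A2 * B2 + (A1 * B2 + A2 * B1) by rewrite /A /B; ring.
    by rewrite lerDl addr_ge0// mulr_ge0.
  by have := supU x; have := supV x; lra.
have mrho := hasI_meas hrho.
have hrho3 : hasI (fun x => rho x ^+ 3) (\int[mu]_x rho x ^+ 3).
  apply: integrable_hasI; apply: integrable_le (hasIZ (8 * (A * B)) hrho).1.
    exact: (measurable_funX 3).
  by move=> x; rewrite ger0_norm ?exprn_ge0// exprSr ler_wpM2r.
have r3 : \int[mu]_x rho x ^+ 3 <= 8 * (A * B) * A.
  apply: hasI_le hrho3 (hasIZ (8 * (A * B)) hrho) => x.
  by rewrite exprSr ler_wpM2r.
move: hrho3 r3; set r3 := Rintegral _ _ _ => hrho3 r3_le.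
have hmass := hasIB hm hm'.
have hEu := euler_lagrange_Q AU sU sdU.
(* Writing |Q + eps|^2 = Q^2 + s with s = 2 Q U + rho, these are the terms of (Q^2 + s)^3 that are
   at least cubic in eps. *)
pose Rm x := 12 * Q x ^+ 3 * U x * rho x + 3 * Q x ^+ 2 * rho x ^+ 2 + (2 * Q x * U x + rho x) ^+ 3.
have hRm : hasI Rm (6 * ((2^-1 * (Kp + Km) + 0 - 2^-1 * (m - m) - 2^-1 * 0) -
     (2^-1 * E1 - 6^-1 * E2))).
  have hE := hasIB (hasIZ 2^-1 hE1) (hasIZ 6^-1 hE2).
  (* Subtracting half the mass difference, whose integral is 0, cancels the terms |eps|^2 / 2 and Q
     U that the quadratic forms and the Euler-Lagrange identity contain but the energy does not. *)
  have hT := hasIB (hasIB (hasID (hasIZ 2^-1 (hasID hKp hKm)) hEu) (hasIZ 2^-1 hmass))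
    (hasIZ 2^-1 pohozaev_Q).
  apply: eq_hasI (hasIZ 6 (hasIB hT hE)) => x; rewrite dQE /Rm /rho.
  have -> : 15 * (1 - th x ^+ 2) = 5 * Q x ^+ 4 by rewrite Q4; ring.
  have -> : 3 * (1 - th x ^+ 2) = Q x ^+ 4 by rewrite Q4.
  by field.
have hbd := hasID (hasIZ (232 * eta) hrho) (hasIZ Ce hrho3).
have Rm_le : 6 * ((2^-1 * (Kp + Km) + 0 - 2^-1 * (m - m) - 2^-1 * 0) -
     (2^-1 * E1 - 6^-1 * E2)) <= 232 * eta * (A1 + A2) + Ce * r3.
  apply: hasI_le hRm hbd => x; rewrite /Rm CeE.
  by apply: remainder_bound => //; rewrite Q_le2 ltW// Q_gt0.
have r3' : Ce * r3 <= c0 * B.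
  have C8 : 0 <= 8 * Ce by rewrite mulr_ge0// ltW.
  have AA : A * A <= delta.
    apply: (@le_trans _ _ (delta ^+ 2 * delta ^+ 2)); first exact: ler_pM.
    rewrite -exprD -[leRHS]expr1; apply: ler_wiXn2l => //; exact: ltW.
  apply: (@le_trans _ _ (Ce * (8 * (A * B) * A))); first by rewrite ler_wpM2l// ltW.
  have -> : Ce * (8 * (A * B) * A) = 8 * Ce * (A * A) * B by ring.
  exact: ler_wpM2r B0 _ _ (le_trans (ler_wpM2l C8 AA) dC).
rewrite eE -/A in Rm_le.
have K_le : c0 * (A + B) <= Kp + Km.
  have -> : c0 * (A + B) = c0 * (A1 + B1) + c0 * (A2 + B2) by rewrite /A /B; ring.
  exact: lerD.
rewrite -/A -/B; have -> : c0 / 3 * (B + A) = c0 * (A + B) / 3 by ring.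
have e1 : c0 * (A + B) = c0 * A + c0 * B by ring.
move: K_le Rm_le r3'; rewrite e1; set ca := c0 * A; set cb := c0 * B.
set rr := Ce * r3; set ee1 := 2^-1 * E1; set ee2 := 6^-1 * E2.
lra.
Qed.

End Energy.

(** * From weak to absolutely continuous representatives *)

Section Transport.
Variable R : realType.
Local Notation mu := (@lebesgue_measure R).
Implicit Types (f g u v U : R -> R) (r : R).

Lemma sqI_ae u U : measurable_fun setT U -> ae_eq mu setT u U -> sqI u -> sqI U.
Proof.
move=> mU uU [_ Iu]; split => //.
have [] // := @hasI_ae R (fun x => u x ^+ 2) (fun x => U x ^+ 2) _ _ _ (integrable_hasI Iu).
  exact: (measurable_funX 2).
by apply: filterS uU => x /= /(_ Logic.I) ->.
Qed.

Lemma H1_representative u du : H1 u du ->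
  exists U, [/\ AC U du, ae_eq mu setT u U, sqI u, sqI U & sqI du].
Proof.
move=> h; have [U [AU uU]] := H1_AC h; have [/L2_sqI su [/L2_sqI sdu _]] := h.
exists U; split => //; apply: sqI_ae uU su.
by apply: continuous_measurable_fun; exact: AC_continuous AU.
Qed.

Lemma orthogonal_hasI u U : measurable_fun setT U -> ae_eq mu setT u U -> sqI u ->
  (\int[@leb R]_x (u x * Q x ^+ 3)%R%:E = 0)%E -> hasI (fun x => Q x ^+ 3 * U x) 0.
Proof.
move=> mU uU su h0.
have h : hasI (fun x => u x * Q x ^+ 3) 0.
  by apply: integral_hasI => //; exact: sqIM su (sqI_QX R 2).
apply: hasI_ae h; first by apply: measurable_funM => //; exact: measurable_QX.
by apply: filterS uU => x /= /(_ Logic.I) ->; rewrite mulrC.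
Qed.

(** One factor of the density is integrable and the square of the density is bounded by the sup
    estimates. Finiteness makes the extended-real difference in [energy] a difference of real
    numbers. *)
Lemma integrable_sextic U dU V dV : AC U dU -> sqI U -> sqI dU ->
  AC V dV -> sqI V -> sqI dV ->
  mu.-integrable setT (EFin \o (fun x => (U x ^+ 2 + V x ^+ 2) ^+ 3)).
Proof.
move=> AU sU sdU AV sV sdV.
have hU := integrable_hasI sU.2; have hdU := integrable_hasI sdU.2.
have hV := integrable_hasI sV.2; have hdV := integrable_hasI sdV.2.
have supU x := sup_bound x AU sU sdU hU hdU.
have supV x := sup_bound x AV sV sdV hV hdV.
have hs := hasID hU hV.
move: supU supV; set CU := 4 * _; set CV := 4 * _ => supU supV.
apply: integrable_le (hasIZ (2 * (CU + CV)) hs).1.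
  exact: (measurable_funX 3 (hasI_meas hs)).
move=> x; have s0 : 0 <= U x ^+ 2 + V x ^+ 2 by rewrite addr_ge0 ?sqr_ge0.
rewrite ger0_norm ?exprn_ge0// exprSr ler_wpM2r//.
have := supU x; have := supV x; have := sqr_ge0 (U x ^+ 2 - V x ^+ 2).
set a := U x ^+ 2; set b := V x ^+ 2 => ab hb ha.
have -> : (a + b) ^+ 2 = 2 * (a ^+ 2 + b ^+ 2) - (a - b) ^+ 2 by ring.
by rewrite lerBlDr (le_trans (ler_wpM2l _ (lerD ha hb)))// lerDl.
Qed.

End Transport.

Unset Implicit Arguments.

(* epsilon = u + i v, with weak derivative eps_x = du + i dv *)
Theorem theorem3p3 (R : realType) :
  exists (delta c : R), 0 < delta /\ 0 < c /\
  forall (u v du dv : R -> R),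
    H1 u du -> H1 v dv ->
    (forall x, u (- x) = u x /\ v (- x) = v x) ->
    (* (eps, Q^3)_{L^2} = Re int eps Q^3 = int u Q^3 = 0 *)
    (\int[@leb R]_x (u x * Q x ^+ 3)%R%:E = 0)%E ->
    (* (eps, i Q^3)_{L^2} = Re int eps conj(i Q^3) = int v Q^3 = 0 *)
    (\int[@leb R]_x (v x * Q x ^+ 3)%R%:E = 0)%E ->
    (L2norm2 u v <= (delta ^+ 2)%R%:E)%E ->
    L2norm2 (fun x => (Q x + u x)%R) v = L2norm2 (@Q R) (fun _ => 0) ->
    (energy (fun x => (Q x + u x)%R) v (fun x => (dQ x + du x)%R) dv >=
     c%:E * (L2norm2 du dv + L2norm2 u v))%E.
Proof.
have [delta [c [d0 [c0 H]]]] := energy_lower_bound R.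
exists delta, c; split => //; split => // u v du dv Hu Hv even h1 h2 hdelta hmass.
have [U [AU uU su sU sdu]] := H1_representative Hu.
have [V [AV vV sv sV sdv]] := H1_representative Hv.
have [[mu_ Iu] [mv Iv] [mU IU] [mV IV]] := And4 su sv sU sV.
have hU := orthogonal_hasI mU uU su h1; have hV := orthogonal_hasI mV vV sv h2.
have hA1 := integrable_hasI IU; have hA2 := integrable_hasI IV.
have hB1 := integrable_hasI sdu.2; have hB2 := integrable_hasI sdv.2.
have L2uv : L2norm2 u v = (\int[@lebesgue_measure R]_x (U x ^+ 2) + \int[@lebesgue_measure R]_x (V x ^+ 2))%:E.
  rewrite /L2norm2; apply: hasI_integral; apply: hasI_ae (hasID hA1 hA2).
    by apply: measurable_funD; exact: (measurable_funX 2).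
  by apply: filterS2 uU vV => x /= /(_ Logic.I) -> /(_ Logic.I) ->.
have sQ := sqI_Q R; have mQ : measurable_fun setT (@Q R) := sQ.1.
have hQ := integrable_hasI sQ.2.
have sQU := sqID sQ sU.
have hm := hasID (integrable_hasI sQU.2) hA2.
have mw : measurable_fun setT (fun x => (Q x + u x) ^+ 2 + v x ^+ 2).
  by apply: measurable_funD; apply: (measurable_funX 2) => //; exact: measurable_funD.
have wae : ae_eq (@lebesgue_measure R) setT (fun x => (Q x + U x) ^+ 2 + V x ^+ 2)
    (fun x => (Q x + u x) ^+ 2 + v x ^+ 2).
  by apply: filterS2 uU vV => x /= /(_ Logic.I) -> /(_ Logic.I) ->.
(* The mass constraint, restated with the same real value as [hm], so that the two integrals cancel
   in the expansion. *)
have hmQ : hasI (fun x : R => Q x ^+ 2) (\int[@lebesgue_measure R]_x (Q x + U x) ^+ 2 + \int[@lebesgue_measure R]_x V x ^+ 2).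
  have hQ0 : hasI (fun x : R => Q x ^+ 2 + 0 ^+ 2) (\int[@lebesgue_measure R]_x Q x ^+ 2).
    by apply: eq_hasI hQ => x; rewrite expr0n addr0.
  move: hmass; rewrite /L2norm2 (hasI_integral (hasI_ae mw wae hm)) (hasI_integral hQ0).
  by move=> [->].
have sdQ : sqI (@dQ R).
  have := sqIZ (-1) (sqI_th sQ); congr sqI; apply/funext => x.
  by rewrite dQE mulN1r.
have hE1 := hasID (integrable_hasI (sqID sdQ sdu).2) hB2.
have hE2 : hasI (fun x => ((Q x + U x) ^+ 2 + V x ^+ 2) ^+ 3)
    (\int[@lebesgue_measure R]_x ((Q x + U x) ^+ 2 + V x ^+ 2) ^+ 3).
  have AQ : AC (@Q R) (@dQ R).
    by apply: AC_eq (@AC_QX R 0) => x; rewrite ?expr1// dQE mul1r.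
  exact: integrable_hasI (integrable_sextic (ACD AQ AU) sQU (sqID sdQ sdu) AV sV sdv).
have hE2' : hasI (fun x => ((Q x + u x) ^+ 2 + v x ^+ 2) ^+ 3)
    (\int[@lebesgue_measure R]_x ((Q x + U x) ^+ 2 + V x ^+ 2) ^+ 3).
  apply: hasI_ae hE2; first exact: (measurable_funX 3 mw).
  by apply: filterS wae => x /= /(_ Logic.I) ->.
rewrite L2uv /energy /L2norm2 (hasI_integral (hasID hB1 hB2)).
rewrite (hasI_integral hE1) (hasI_integral hE2') -EFinD -!EFinM -EFinB lee_fin.
apply: (H u U du V dv) hm hmQ hE1 hE2 => //; first by move=> x; have [] := even x.
by rewrite -lee_fin -L2uv.
Qed.
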